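(* Let $n\ge2$, $1\le k\le n-1$, $\alpha_1,\alpha_2\in\mathbb{R}$ with $\alpha_1\ge k-n$, and $p=\frac{\alpha_1+n}{k}\ge1+\alpha_2$, with strict inequality $p>1+\alpha_2$ when $\alpha_2>0$. For $\gamma\in\mathbb{R}$ consider $$\|\cos^\gamma d(0,\cdot)\,R_kf\|_{L^\infty(\Xi_k(\mathbb{S}^n))}\le C\|f\|_{L^{p,1}_{\alpha_1,\alpha_2}(\mathbb{S}^n)}\quad\text{for all even radial }f\in L^{p,1}_{\alpha_1,\alpha_2}(\mathbb{S}^n).\qquad( * )$$ (A) If $k\ge2$, $( * )$ holds if and only if $\gamma\ge\frac{1+\alpha_2}{p}$. (B) If $k=1$, $( * )$ holds if and only if $\gamma\ge\frac{1+\alpha_2}{p}$ and $p\ge2$.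
   Context: $\mathbb{S}^n\subset\mathbb{R}^{n+1}$ unit sphere with origin $0:=e_{n+1}$, distance $d$, surface measure $dx$. $\Xi_k(\mathbb{S}^n)$: $k$-dimensional totally geodesic submanifolds (intersections with $(k+1)$-dimensional linear subspaces) with $d(0,\xi)<\pi/2$, with rotation-invariant measure ($L^\infty$ = essential supremum). $R_kf(\xi)=\int_\xi f\,d_\xi x$. $L^{p,1}_{\alpha_1,\alpha_2}(\mathbb{S}^n)$ is the Lorentz space $L^{p,1}(\mathbb{S}^n,\mu)$ for $d\mu=\sin^{\alpha_1}d(0,x)|\cos d(0,x)|^{\alpha_2}dx$, with norm $p\int_0^\infty\mu(\{|f|>s\})^{1/p}ds$. Even radial: $f(x)=F(|x_{n+1}|)$. $C$ independent of $f$. *)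

(* Defs.v *)
From HB Require Import structures.
From mathcomp Require Import all_boot all_order all_algebra.
From mathcomp Require Import all_classical all_reals all_analysis.
Set Implicit Arguments. Unset Strict Implicit. Unset Printing Implicit Defensive.
Import Order.TTheory GRing.Theory Num.Theory.
Import numFieldNormedType.Exports.
Local Open Scope classical_set_scope.
Local Open Scope ring_scope.

Section Defs.
Variable R : realType.

(* Euclidean norm of a row vector in R^m (the library norm on matrices is the
   sup norm, so we define the Euclidean one explicitly). *)
Definition enorm (m : nat) (x : 'rV[R]_m) : R :=
  Num.sqrt (\sum_(i < m) (x ord0 i) ^+ 2).

(* Iterated one-dimensional Lebesgue integrals over R^m; for nonnegative
   Borel integrands this is (Tonelli) the m-dimensional Lebesgue integral. *)
Fixpoint iterint (m : nat) : ('rV[R]_m -> \bar R) -> \bar R :=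
  match m return ('rV[R]_m -> \bar R) -> \bar R with
  | 0 => fun g => g 0
  | m'.+1 => fun g =>
      (\int[@lebesgue_measure R]_(t in [set: R])
         iterint (fun v : 'rV[R]_m' => g (row_mx (\row_(j < 1) t) v)))%E
  end.

(* The unit sphere S^n in R^{n+1}; the origin of S^n is e_{n+1}, i.e. the
   last coordinate (index ord_max). *)
Definition sphere (n : nat) : set 'rV[R]_n.+1 := [set x | enorm x = 1].

Definition d0 (n : nat) (x : 'rV[R]_n.+1) : R := acos (x ord0 ord_max).

(* Integral over S^n w.r.t. the surface measure dx (cone/polar-coordinate
   formula: int_{S^n} g = (n+1) int_{0<|y|<=1} g(y/|y|) dy). *)
Definition sphint (n : nat) (g : 'rV[R]_n.+1 -> \bar R) : \bar R :=
  ((n.+1)%:R%:E * iterint (fun y : 'rV[R]_n.+1 =>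
     if ((0 < enorm y) && (enorm y <= 1))%R then g ((enorm y)^-1 *: y) else 0%E))%E.

Definition weight (n : nat) (a1 a2 : R) (x : 'rV[R]_n.+1) : R :=
  (sin (d0 x)) `^ a1 * `|cos (d0 x)| `^ a2.

Definition mu (n : nat) (a1 a2 : R) (A : set 'rV[R]_n.+1) : \bar R :=
  sphint (fun x => ((\1_A x : R) * weight a1 a2 x)%:E).

Definition lorentz_norm (n : nat) (a1 a2 p : R) (f : 'rV[R]_n.+1 -> R)
  : \bar R :=
  (p%:E * \int[@lebesgue_measure R]_(s in `]0%R, +oo[%classic : set R)
     (mu a1 a2 [set x | ((s : R) < `|f x|)%R]) `^ p^-1)%E.

Definition even_radial (n : nat) (f : 'rV[R]_n.+1 -> R) : Prop :=
  exists F : R -> R, measurable_fun [set: R] F /\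
    forall x, @sphere n x -> f x = F `|x ord0 ord_max|.

(* k-dimensional totally geodesic submanifolds of S^n: xi = S^n cap V with V
   the (k+1)-dimensional row space of a rank-(k+1) matrix G. *)
Definition xi (n k : nat) (G : 'M[R]_(k.+1, n.+1)) : set 'rV[R]_n.+1 :=
  [set x | @sphere n x /\ exists y : 'rV[R]_k.+1, x = y *m G].

Definition dist0 (n k : nat) (G : 'M[R]_(k.+1, n.+1)) : R :=
  inf [set d0 x | x in xi G].

(* R_k f (xi) = int_xi f d_xi x.  With x = y G (y in R^{k+1}) Lebesgue measure
   on V is sqrt(det(G G^T)) dy, and the cone formula on the k-sphere xi gives
   int_xi f = (k+1) sqrt(det(G G^T)) int_{0<|yG|<=1} f(yG/|yG|) dy. *)
Definition radon (n k : nat) (G : 'M[R]_(k.+1, n.+1)) (f : 'rV[R]_n.+1 -> R)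
  : \bar R :=
  ((k.+1)%:R%:E * (Num.sqrt (\det (G *m G^T)))%:E *
   iterint (fun y : 'rV[R]_k.+1 =>
     let x := y *m G in
     if ((0 < enorm x) && (enorm x <= 1))%R then (f ((enorm x)^-1 *: x))%:E
     else 0%E))%E.

Definition admissible (n k : nat) (G : 'M[R]_(k.+1, n.+1)) : bool :=
  (\rank G == k.+1) && (dist0 G < pi / 2).

Definition mx_null (m1 m2 : nat) (A : set 'M[R]_(m1, m2)) : Prop :=
  forall eps : R, 0 < eps ->
    exists a b : nat -> 'M[R]_(m1, m2),
      (A `<=` \bigcup_j [set M | forall i l, a j i l <= M i l <= b j i l]) /\
      (\sum_(0 <= j <oo) (\prod_(i < m1) \prod_(l < m2) (Num.max (b j i l - a j i l) 0))%:E
        <= eps%:E)%E.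

(* The parametrisation G |-> row space of G pushes Lebesgue (equivalently
   Gaussian) measure on matrices to a measure on the Grassmannian equivalent
   to the rotation-invariant one; hence null sets of Xi_k correspond to
   Lebesgue-null sets of parameters G. Essential supremum over Xi_k: *)
Definition esssup_Xi (n k : nat) (h : 'M[R]_(k.+1, n.+1) -> \bar R) : \bar R :=
  ereal_inf [set M : \bar R | mx_null [set G | admissible G /\ (M < h G)%E]].

Definition weighted_radon_sup (n k : nat) (gam : R) (f : 'rV[R]_n.+1 -> R)
  : \bar R :=
  esssup_Xi (fun G : 'M[R]_(k.+1, n.+1) =>
    ((cos (dist0 G)) `^ gam)%:E * `|radon G f|)%E.

Definition ineq_star (n k : nat) (a1 a2 p gam : R) : Prop :=
  exists C : R, forall f : 'rV[R]_n.+1 -> R,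
    even_radial f -> (lorentz_norm a1 a2 p f < +oo)%E ->
    (weighted_radon_sup k gam f <= C%:E * lorentz_norm a1 a2 p f)%E.

End Defs.

(* Main.v *)
Require Import Defs.
From HB Require Import structures.
From mathcomp Require Import all_boot all_order all_algebra.
From mathcomp Require Import all_classical all_reals all_analysis.
From mathcomp Require Import measurable_realfun ring lra.
Import Order.TTheory GRing.Theory Num.Theory.
Import numFieldNormedType.Exports.
Local Open Scope classical_set_scope.
Local Open Scope ring_scope.

(** Let [c] be the norm of the projection of the pole onto the subspace spanned
    by [xi], so that [c] is the cosine of the distance of [xi] to the pole.
    Gram-Schmidt, rotation invariance and homogeneity reduce both integrals to
    the real line: with [x = tan^2] of the distance to the point of [xi] closest
    to the pole, the Radon transform of [F(|x_{n+1}|)] is a constant times the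
    integral over [x > 0] of [F(c (1 + x)^(-1/2)) g(x)], where
    [g(x) = x^(k/2 - 1) (1 + x)^(-(k + 1)/2)], and the weighted surface measure
    has in the same way (with [c = 1]) the density
    [w(x) = x^(kp/2 - 1) (1 + x)^(-(kp + 1 + a2)/2)].

    Sufficiency: by the layer-cake formula it is enough to treat indicator
    functions.  The affine substitution [1 + x := (1 + x) / c^2] costs a factor
    [c^(1 + a2)] as soon as [kp >= 2], and for sets [E] the estimate
    [int_E g <= C (int_E w)^(1/p)] holds because [w >= th^(p-1) g] for a function
    [th] with [int_{th < y} g <= K y].

    Necessity: one tests with indicator functions of bands; for [gam] the bands
    [|x_{n+1}| ~ c] with [c -> 0], and for [k = 1] bands of width [t -> 0] whose
    upper edge touches [xi], where [g] has an integrable singularity and the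
    integral is of order [t^(1/2)] against [t^(1/p)].  The essential supremum
    sees these [xi] since [c] depends continuously on a spanning matrix and
    boxes of matrices are not null. *)

Ltac measurability :=
  repeat lazymatch goal with
    | |- measurable_fun _ (fun x => x) => exact: measurable_id
    | |- measurable_fun _ fst => exact: measurable_fst
    | |- measurable_fun _ snd => exact: measurable_snd
    | |- measurable_fun _ EFin => exact: EFin_measurable
    | |- measurable_fun _ (fun x => fst x) => exact: measurable_fst
    | |- measurable_fun _ (fun x => snd x) => exact: measurable_snd
    | |- measurable_fun _ (fun x => fst _) =>
        apply: (measurableT_comp (@measurable_fst _ _ _ _))
    | |- measurable_fun _ (fun x => snd _) =>
        apply: (measurableT_comp (@measurable_snd _ _ _ _))
    | |- measurable_fun _ (fun x => (EFin _)) => apply/measurable_EFinP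
    | |- measurable_fun _ (fun x => (_ * _)%E) => apply: emeasurable_funM
    | |- measurable_fun _ (fun x => (_ + _)%E) => apply: emeasurable_funD
    | |- measurable_fun _ (fun x => if _ then _ else _) => apply: measurable_fun_ifT
    | |- measurable_fun _ (fun x => _ && _) => apply: measurable_and
    | |- measurable_fun _ (fun x => (_ < _)%R) => apply: measurable_fun_ltr
    | |- measurable_fun _ (fun x => (_ <= _)%R) => apply: measurable_fun_ler
    | |- measurable_fun _ (fun x => (- _)%R) => apply: measurable_funN
    | |- measurable_fun _ (fun x => (_ + _)%R) => apply: measurable_funD
    | |- measurable_fun _ (fun x => (_ * _)%R) => apply: measurable_funM
    | |- measurable_fun _ (fun x => (_ ^+ _)%R) => apply: measurable_funX
    | |- measurable_fun _ (fun x => (_ `^ _)%R) =>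
        apply: (measurableT_comp (measurable_powR _))
    | |- measurable_fun _ (fun x => `|_|%R) =>
        apply: (measurableT_comp (@normr_measurable _ setT))
    | |- measurable_fun _ (fun x => (_, _)) => apply/measurable_fun_pair
    | H : measurable_fun setT ?f |- measurable_fun _ ?f => exact: H
    | H : measurable_fun setT ?f |- measurable_fun _ (fun x => ?f _) =>
        apply: (measurableT_comp H)
    | |- measurable_fun _ (fun=> _) => exact: measurable_cst
    | |- measurable_fun ?D (?h ?a) => change (measurable_fun D (fun x => h a x))
    end.

(** * Monotonicity, Tonelli and affine substitution on the real line *)

Section RealLine.
Variable R : realType.
Notation leb := (@lebesgue_measure R).
Implicit Types (f g : R -> \bar R).

(** The integral of a nonnegative function, measurable or not, is the supremum over the simple
    functions below it, and this family grows with the function. *)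
Lemma le_ge0_integral {d} {T : measurableType d} (m : {measure set T -> \bar R})
    (D : set T) (f g : T -> \bar R) :
  (forall x, D x -> (0 <= f x)%E) -> (forall x, D x -> (f x <= g x)%E) ->
  (\int[m]_(x in D) f x <= \int[m]_(x in D) g x)%E.
Proof.
move=> f0 fg.
rewrite !ge0_integralE//; last by move=> x Dx; exact: le_trans (f0 _ Dx) (fg _ Dx).
apply: le_ereal_sup => _ [h hf <-]; exists h => // x.
apply: le_trans (hf x) _; rewrite /patch; case: ifPn => //; rewrite inE => Dx.
exact: fg.
Qed.

(* No measurability is needed: both the positive and the negative part are at most
   the integral of the absolute value. *)
Lemma abse_integral_le {d} {T : measurableType d} (m : {measure set T -> \bar R})
    (D : set T) (f : T -> \bar R) :
  (`|\int[m]_(x in D) f x| <= \int[m]_(x in D) `|f x|)%E.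
Proof.
rewrite integralE.
set a := (\int[m]_(x in D) f^\+ x)%E; set b := (\int[m]_(x in D) f^\- x)%E.
set c := (\int[m]_(x in D) `|f x|)%E.
have a0 : (0 <= a)%E by apply: integral_ge0.
have b0 : (0 <= b)%E by apply: integral_ge0.
have ac : (a <= c)%E.
  apply: le_ge0_integral => x _ //.
  by rewrite funeposE ge_max lee_abs abse_ge0.
have bc : (b <= c)%E.
  apply: le_ge0_integral => x _ //.
  by rewrite funenegE ge_max abse_ge0 -abseN lee_abs.
have [->|cy] := eqVneq c +oo%E; first exact: leey.
have fc : (c < +oo)%E by rewrite ltey.
have fa : (a < +oo)%E := le_lt_trans ac fc.
have fb : (b < +oo)%E := le_lt_trans bc fc.
move: a0 b0 ac bc fa fb fc {cy}.
case: a b c => [a| |] [b| |] [c| |]//=; rewrite !lee_fin.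
by move=> a0 b0 ac bc _ _ _; rewrite ler_norml; lra.
Qed.

Lemma integral_swap (f : R * R -> \bar R) :
  measurable_fun setT f -> (forall x, 0 <= f x)%E ->
  (\int[leb]_x \int[leb]_y f (x, y) = \int[leb]_y \int[leb]_x f (x, y))%E.
Proof. by move=> mf f0; exact: (@fubini_tonelli _ _ _ _ _ leb leb f mf f0). Qed.

Lemma measurable_integral_snd {d} {T : measurableType d} (f : T * R -> \bar R) :
  measurable_fun setT f -> (forall x, 0 <= f x)%E ->
  measurable_fun setT (fun x => \int[leb]_y f (x, y))%E.
Proof. by move=> mf f0; exact: (measurable_fun_fubini_tonelli_F (m2 := leb) f). Qed.

Lemma integral_oppr f : measurable_fun setT f -> (forall x, 0 <= f x)%E ->
  (\int[leb]_x f (- x)%R = \int[leb]_x f x)%E.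
Proof.
move=> mf f0.
have := @ge0_integral_pushforward _ _ (measurableTypeR R) (measurableTypeR R) R
  (-%R : measurableTypeR R -> measurableTypeR R)
  (@oppr_measurable R setT) leb setT f measurableT mf (fun x _ => f0 x).
rewrite preimage_setT => <-.
by apply: eq_measure_integral => A mA _; exact: lebesgue_measureN.
Qed.

(** Lebesgue measure is determined by its values on half-open intervals, and there it agrees with
    [a] times its image under [x |-> a * x + b]. *)
Let integral_affine_gt0 f (a b : R) : measurable_fun setT f -> (forall x, 0 <= f x)%E ->
  0 < a -> (\int[leb]_x f x = a%:E * \int[leb]_x f (a * x + b)%R)%E.
Proof.
move=> mf f0 a0.
pose phi : measurableTypeR R -> measurableTypeR R := fun x => a * x + b.
have mphi0 : measurable_fun setT (fun x : R => a * x + b : R) by measurability.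
have mphi : measurable_fun setT phi := mphi0.
have := @ge0_integral_pushforward _ _ (measurableTypeR R) (measurableTypeR R) R
  phi mphi leb setT f measurableT mf (fun x _ => f0 x).
rewrite preimage_setT => <-.
pose phiM := isMeasurableFun.Build _ _ _ _ _ mphi.
pose phiP : {mfun _ >-> _} := HB.pack phi phiM.
pose an : {nonneg R} := NngNum (ltW a0).
rewrite -(@ge0_integral_mscale _ _ R (pushforward leb phiP) setT measurableT an f)//.
apply: eq_measure_integral => A mA _.
apply: lebesgue_measure_unique => // _ [[u v]] _ <- /=.
rewrite /mscale/= /pushforward/=.
have -> : phi @^-1` `]u, v]%classic = `](u - b) / a, (v - b) / a]%classic.
  apply/seteqP; split => x /=; rewrite !in_itv/= /phi;
    by rewrite ltr_pdivrMr// ler_pdivlMr// ltrBlDr lerBrDr [x * a]mulrC.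
rewrite !lebesgue_measure_itv/= !lte_fin.
rewrite ltr_pdivrMr// divfK ?gt_eqF// ltrD2r.
case: ifPn => _; last by rewrite mule0.
by rewrite -EFinB -EFinM; congr (_%:E); field; rewrite gt_eqF.
Qed.

Lemma integral_affine f (a b : R) : measurable_fun setT f -> (forall x, 0 <= f x)%E ->
  a != 0 -> (\int[leb]_x f x = `|a|%:E * \int[leb]_x f (a * x + b)%R)%E.
Proof.
move=> mf f0; rewrite neq_lt => /orP[a0|a0]; last first.
  by rewrite gtr0_norm//; exact: integral_affine_gt0.
rewrite ltr0_norm// (@integral_affine_gt0 _ (- a) b)// ?oppr_gt0//.
congr (_ * _)%E; rewrite -integral_oppr.
- by under eq_integral do rewrite mulrNN.
- by apply: (measurableT_comp mf); measurability.
- by move=> x; exact: f0.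
Qed.

Lemma integral_scale f (a : R) : measurable_fun setT f -> (forall x, 0 <= f x)%E ->
  0 < a -> (\int[leb]_x f x = a%:E * \int[leb]_x f (a * x)%R)%E.
Proof.
move=> mf f0 a0; rewrite (@integral_affine_gt0 _ a 0)//.
by under eq_integral do rewrite addr0.
Qed.

Lemma integral_shift f (b : R) : measurable_fun setT f -> (forall x, 0 <= f x)%E ->
  (\int[leb]_x f x = \int[leb]_x f (x + b)%R)%E.
Proof.
move=> mf f0; rewrite (@integral_affine_gt0 _ 1 b)// mul1e.
by under eq_integral do rewrite mul1r.
Qed.

End RealLine.

(** * Integration along lines, in terms of squared norm and one coordinate *)

Section LineIntegral.
Variable R : realType.
Notation leb := (@lebesgue_measure R).
Implicit Types (P : R * R -> \bar R).

(** A pair stands for the squared norm and a fixed coordinate of a vector. Moving by [t] along a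
    unit vector orthogonal to it, whose own coordinate is [q], adds [t ^+ 2] and [t * q] to the
    pair. *)
Definition lineint (q : R) P (ab : R * R) : \bar R :=
  (\int[leb]_t P (ab.1 + t ^+ 2, ab.2 + t * q)%R)%E.

Lemma lineint_ge0 q P : (forall x, 0 <= P x)%E -> forall x, (0 <= lineint q P x)%E.
Proof. by move=> P0 x; exact: integral_ge0. Qed.

Lemma measurable_lineint q P : measurable_fun setT P -> (forall x, 0 <= P x)%E ->
  measurable_fun setT (lineint q P).
Proof.
move=> mP P0; apply: (measurable_integral_snd _
  (fun z : (R * R) * R => P (z.1.1 + z.2 ^+ 2, z.1.2 + z.2 * q)%R)); last by [].
by measurability.
Qed.

Lemma iter_lineint_ge0 m q P : (forall x, 0 <= P x)%E ->
  forall x, (0 <= iter m (lineint q) P x)%E.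
Proof. by move=> P0; elim: m => //= m ih; exact: lineint_ge0. Qed.

Lemma measurable_iter_lineint m q P : measurable_fun setT P ->
  (forall x, 0 <= P x)%E -> measurable_fun setT (iter m (lineint q) P).
Proof.
move=> mP P0; elim: m => //= m ih; apply: measurable_lineint => //.
exact: iter_lineint_ge0.
Qed.

Lemma lineintN q P : measurable_fun setT P -> (forall x, 0 <= P x)%E ->
  lineint (- q) P = lineint q P.
Proof.
move=> mP P0; apply/funext => ab; rewrite /lineint -[RHS]integral_oppr//.
  by under [RHS]eq_integral do rewrite sqrrN mulNr -mulrN.
by measurability.
Qed.

(* In the plane of the two integration variables [(q, q')] is rotated onto [(r, 0)]. *)
Lemma lineint_rotate q q' r P : measurable_fun setT P -> (forall x, 0 <= P x)%E ->
  r ^+ 2 = q ^+ 2 + q' ^+ 2 ->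
  lineint q (lineint q' P) = lineint r (lineint 0 P).
Proof.
move=> mP P0 rq; have [q'0|q'0] := eqVneq q' 0.
  rewrite q'0; have mP' := measurable_lineint 0 P mP P0.
  have P'0 := lineint_ge0 0 P P0.
  move/eqP: rq; rewrite q'0 expr0n addr0 eqf_sqr => /orP[]/eqP->.
    by [].
  by rewrite lineintN.
have r0 : r != 0.
  apply/eqP => r0; move: rq; rewrite r0 expr0n /= => /esym/eqP.
  by rewrite paddr_eq0 ?sqr_ge0// !sqrf_eq0 (negbTE q'0) andbF.
apply/funext => -[a b].
pose C := q' / r; pose S := q / r.
have C0 : C != 0 by rewrite mulf_neq0// invr_eq0.
have CS : S ^+ 2 = 1 - C ^+ 2.
  by rewrite /C /S !expr_div_n rq; field; rewrite -rq sqrf_eq0.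
have qE : q = r * S by rewrite /S mulrC divfK.
have q'E : q' = r * C by rewrite /C mulrC divfK.
rewrite /lineint/=.
(* Two shears perform the rotation: for fixed [s] the inner variable [t] gives way to
   [u = C * t + S * s], and after exchanging the integrals [s] is replaced by [C * s + u * S] for
   fixed [u]. Their factors [|C^-1|] and [|C|] cancel. *)
pose K s u := P (a + s ^+ 2 + (C^-1 * u + - (s * S / C)) ^+ 2, b + r * u).
have mK : measurable_fun setT (fun z : R * R => K z.1 z.2).
  by rewrite /K; measurability.
have mK1 s : measurable_fun setT (K s) by rewrite /K; measurability.
have mK2 u : measurable_fun setT (fun s => K s u) by rewrite /K; measurability.
have K0 s u : (0 <= K s u)%E by exact: P0.
transitivity (\int[leb]_s (`|C^-1|%:E * \int[leb]_u K s u))%E.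
  apply: eq_integral => s _.
  rewrite [LHS](@integral_affine _ _ C^-1 (- (s * S / C))) ?invr_eq0//.
    congr (_ * _)%E; apply: eq_integral => u _; rewrite /K; congr (P (_, _)).
    by rewrite qE q'E; field.
  by measurability.
rewrite ge0_integralZl//; last 2 first.
- by apply: (measurable_integral_snd _ (fun z : R * R => K z.1 z.2)).
- by move=> s _; exact: integral_ge0.
rewrite (integral_swap _ (fun z : R * R => K z.1 z.2))//=.
rewrite -ge0_integralZl//; last 2 first.
- apply: (measurable_integral_snd _ (fun z : R * R => K z.2 z.1)) => //.
  by rewrite /K; measurability.
- by move=> s _; exact: integral_ge0.
apply: eq_integral => u _.
rewrite [X in (_ * X)%E](@integral_affine _ _ C (u * S))// muleA -EFinM -normrM mulVf// normr1 mul1e.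
apply: eq_integral => s _; rewrite /K; congr (P (_, _)); last first.
  by rewrite mulr0 addr0 mulrC.
have -> : C^-1 * u + - ((C * s + u * S) * S / C) = u * C - S * s.
  have -> : (C * s + u * S) * S = C * s * S + u * S ^+ 2 by ring.
  by rewrite CS; field.
rewrite -!addrA; congr (a + _).
have -> : (C * s + u * S) ^+ 2 + (u * C - S * s) ^+ 2 =
  (C ^+ 2 + S ^+ 2) * (s ^+ 2 + u ^+ 2) by ring.
by rewrite CS; ring.
Qed.

End LineIntegral.

(** * Gram-Schmidt reduction of an integral over a row space *)

Section GramSchmidt.
Variables (R : realType) (N : nat).
Implicit Types (x y u w : 'rV[R]_N) (P : R * R -> \bar R).

Definition dotr x y : R := (x *m y^T) ord0 ord0.

Definition sqn x : R := \sum_i x ord0 i ^+ 2.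

Lemma sqnE x : sqn x = dotr x x.
Proof.
by rewrite /dotr mxE; apply: eq_bigr => i _; rewrite mxE expr2.
Qed.

Lemma sqn_ge0 x : 0 <= sqn x.
Proof. by apply: sumr_ge0 => i _; exact: sqr_ge0. Qed.

Lemma sqn_eq0 x : (sqn x == 0) = (x == 0).
Proof.
apply/idP/eqP => [|->]; last first.
  by rewrite /sqn big1// => i _; rewrite mxE expr0n.
rewrite psumr_eq0 => [/allP x0|i _]; last exact: sqr_ge0.
apply/rowP => i; apply/eqP; rewrite [X in _ == X]mxE -sqrf_eq0.
by have := x0 i (mem_index_enum _).
Qed.

Lemma sqnZ (a : R) x : sqn (a *: x) = a ^+ 2 * sqn x.
Proof. by rewrite /sqn mulr_sumr; apply: eq_bigr => i _; rewrite mxE exprMn. Qed.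

Lemma sqnD x y : sqn (x + y) = sqn x + 2 * dotr x y + sqn y.
Proof.
rewrite /sqn /dotr mxE mulr_sumr -!big_split/=.
by apply: eq_bigr => i _; rewrite !mxE; ring.
Qed.

(** For orthonormal rows of [Q] this is the component of [w] orthogonal to the row space of [Q]. *)
Definition perp m (Q : 'M[R]_(m, N)) w : 'rV[R]_N := w - w *m Q^T *m Q.

(** Induction on the rows. The part of the first row orthogonal to the others is [h *: u] with [u]
    of norm 1; an affine substitution in its variable produces the factor [h^-1], and [h] is the new
    diagonal entry of the triangular matrix [T]. The base point [w] is arbitrary because the inner
    integrals see it displaced along the first row. The list [qs] collects the coordinate [l] of the
    orthonormal rows. *)
Lemma iterint_gram_schmidt (l : 'I_N) m (G : 'M[R]_(m, N)) : row_free G ->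
  exists (Q : 'M[R]_(m, N)) (T : 'M[R]_m) (qs : seq R),
    [/\ G = T *m Q, Q *m Q^T = 1%:M, 0 < \det T,
        size qs = m /\ \sum_(q <- qs) q ^+ 2 = \sum_i (Q i l) ^+ 2 &
        forall P, measurable_fun setT P -> (forall z, 0 <= P z)%E -> forall w,
          iterint (fun v : 'rV[R]_m =>
            P (sqn (w + v *m G), (w + v *m G) ord0 l)) =
          (((\det T)^-1)%:E *
            foldr (@lineint R) P qs (sqn (perp m Q w), perp m Q w ord0 l))%E].
Proof.
elim: m G => [|m ih] G Gfree.
  exists 0, 1%:M, [::]; split.
  - by rewrite mulmx0; apply: flatmx0.
  - by rewrite [RHS]flatmx0; apply: flatmx0.
  - by rewrite det1.
  - by rewrite big_nil big_ord0.
  move=> P mP P0 w /=; rewrite det1 invr1 mul1e mul0mx /perp.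
  by rewrite mulmx0 addr0 subr0.
pose g : 'rV[R]_N := usubmx (G : 'M[R]_(1 + m, N)).
pose G' : 'M[R]_(m, N) := dsubmx (G : 'M[R]_(1 + m, N)).
have GE : G = col_mx g G' by rewrite vsubmxK.
have Ginj (a : 'rV[R]_(1 + m)) : a *m col_mx g G' = 0 -> a = 0.
  by rewrite -GE => aG; apply/(row_free_inj Gfree); rewrite aG mul0mx.
have G'free : row_free G'.
  apply: inj_row_free => v vG'.
  have := Ginj (row_mx 0 v); rewrite mul_row_col mul0mx add0r vG' => /(_ erefl).
  by move/(congr1 rsubmx); rewrite row_mxKr linear0.
have [Q [T [qs [G'E QQ T0 [sqs sumqs] IH]]]] := ih _ G'free.
pose go := perp m Q g.
(* Otherwise the first row would be a combination of the others. *)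
have go0 : go != 0.
  apply/eqP => go0.
  have gE : g = g *m Q^T *m invmx T *m G'.
    rewrite G'E !mulmxA mulmxKV; first by apply/eqP; rewrite -subr_eq0; exact/eqP.
    by rewrite unitmxE unitfE gt_eqF.
  have := Ginj (row_mx 1%:M (- (g *m Q^T *m invmx T))).
  rewrite mul_row_col mul1mx mulNmx -gE subrr => /(_ erefl).
  move/(congr1 lsubmx); rewrite row_mxKl linear0 => /matrixP/(_ ord0 ord0).
  by rewrite !mxE/= => /eqP; rewrite oner_eq0.
pose h := Num.sqrt (sqn go).
have h0 : 0 < h by rewrite sqrtr_gt0 lt0r sqn_eq0 go0 sqn_ge0.
pose u := h^-1 *: go.
have goE : go = h *: u by rewrite scalerA divff ?gt_eqF// scale1r.
have goQ : go *m Q^T = 0 by rewrite /go /perp mulmxBl -!mulmxA QQ mulmx1 subrr.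
have uQ : u *m Q^T = 0 by rewrite -scalemxAl goQ scaler0.
have Qu : Q *m u^T = 0 by rewrite -[LHS]trmxK trmx_mul trmxK uQ trmx0.
have u1 : sqn u = 1.
  rewrite sqnZ exprVn sqr_sqrtr ?sqn_ge0// mulVf//.
  by rewrite sqn_eq0.
have uu : u *m u^T = 1%:M.
  by apply/matrixP => i j; rewrite !ord1 -[LHS]sqnE u1 mxE eqxx.
pose Qp : 'M[R]_(1 + m, N) := col_mx u Q.
pose Tp : 'M[R]_(1 + m) := block_mx h%:M (g *m Q^T) 0 T.
have detTp : \det Tp = h * \det T.
  by rewrite det_ublock det_scalar1.
have perpp w : perp (1 + m) Qp w = perp m Q w - (dotr w u) *: u.
  rewrite /perp /Qp tr_col_mx mul_mx_row mul_row_col opprD addrA addrAC.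
  congr (_ - _).
  rewrite -mul_scalar_mx; congr (_ *m _).
  by apply/matrixP => i j; rewrite !ord1 [RHS]mxE eqxx mulr1n.
have TQp : col_mx g G' = Tp *m Qp.
  rewrite /Tp /Qp mul_block_col mul0mx add0r -G'E mul_scalar_mx -goE.
  by rewrite /go /perp subrK.
have QQp : Qp *m Qp^T = 1%:M.
  by rewrite /Qp tr_col_mx mul_col_row uu uQ Qu QQ -scalar_mx_block.
have sumQp : u ord0 l ^+ 2 + \sum_i Q i l ^+ 2 = \sum_i Qp i l ^+ 2.
  rewrite [RHS](big_split_ord)/= big_ord1.
  by rewrite col_mxEu; congr (_ + _); apply: eq_bigr => i _; rewrite col_mxEd.
exists Qp, Tp, (u ord0 l :: qs); split => //.
- by rewrite GE.
- by rewrite detTp mulr_gt0.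
- by rewrite /= sqs big_cons sumqs.
move=> P mP P0 w /=.
set Psi := foldr (@lineint R) P qs.
have Psi0 z : (0 <= Psi z)%E.
  by rewrite /Psi; elim: (qs) z => //= q s IHs z; exact: lineint_ge0.
have mPsi : measurable_fun setT Psi.
  rewrite /Psi {Psi0 Psi sqs sumqs IH}; elim: qs => //= q s IHs.
  apply: measurable_lineint => // z.
  by elim: s z {IHs} => //= q' s IHs z; exact: lineint_ge0.
pose wo := perp (1 + m) Qp w.
have wou : dotr wo u = 0.
  rewrite /dotr /wo perpp mulmxBl /perp mulmxBl -!mulmxA Qu !mulmx0 subr0.
  by rewrite -scalemxAl uu scalemx1 [LHS]mxE [X in _ + X]mxE [X in - X]mxE eqxx mulr1n subrr.
(* For fixed [t] the other variables are integrated by the induction hypothesis at the base point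
   [w + t *: g], whose component orthogonal to the rows of [Q] is [wo + (h * t + dotr w u) *: u]. *)
have step (t : R) : iterint (fun v : 'rV[R]_m =>
    P (sqn (w + row_mx (\row_(j < 1) t) v *m G),
       (w + row_mx (\row_(j < 1) t) v *m G) ord0 l)) =
    (((\det T)^-1)%:E * Psi (sqn wo + (h * t + dotr w u) ^+ 2,
       wo ord0 l + (h * t + dotr w u) * u ord0 l)%R)%E.
  have tE : (\row_(j < 1) t : 'rV[R]_1) = t%:M.
    by apply/matrixP => i j; rewrite !ord1 !mxE eqxx.
  have -> : (fun v : 'rV[R]_m => P (sqn (w + row_mx (\row_(j < 1) t) v *m G),
       (w + row_mx (\row_(j < 1) t) v *m G) ord0 l)) =
     (fun v : 'rV[R]_m => P (sqn ((w + t *: g) + v *m G'), ((w + t *: g) + v *m G') ord0 l)).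
    by apply/funext => v; rewrite GE tE mul_row_col mul_scalar_mx !addrA.
  rewrite IH//.
  have -> : perp m Q (w + t *: g) = wo + (h * t + dotr w u) *: u.
    have -> : perp m Q (w + t *: g) = perp m Q w + t *: go.
      by rewrite /perp !mulmxDl -!scalemxAl /go /perp scalerBr opprD addrACA.
    by rewrite /wo perpp scalerDl [X in _ = _ + X]addrC addrA subrK goE scalerA mulrC.
  congr (_ * Psi (_, _))%E; last by rewrite !mxE.
  rewrite sqnD sqnZ u1 mulr1 /dotr linearZ/= -scalemxAr mxE -/(dotr _ _).
  by rewrite [(wo *m u^T) _ _]wou !mulr0 addr0.
under eq_integral => t _ do rewrite step.
rewrite ge0_integralZl_EFin ?invr_ge0 ?ltW//; last by measurability.
rewrite detTp invfM EFinM [((h^-1)%:E * _)%E]muleC -muleA; congr (_ * _)%E.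
rewrite [in RHS]/lineint (@integral_affine _ _ h (dotr w u)) ?gt_eqF//; last by measurability.
by rewrite muleA -EFinM gtr0_norm// mulVf ?gt_eqF// mul1e.
Qed.

End GramSchmidt.

(** * Radial integration in terms of the squared radius *)

Section Radial.
Variable R : realType.
Notation leb := (@lebesgue_measure R).
Implicit Types (P : R * R -> \bar R) (psi : R -> \bar R).

(** Rotating two directions at a time gathers all the coordinates in the first direction and leaves
    0 for the others. *)
Lemma foldr_lineint q qs r P : measurable_fun setT P -> (forall z, 0 <= P z)%E ->
  r ^+ 2 = \sum_(x <- q :: qs) x ^+ 2 ->
  foldr (@lineint R) P (q :: qs) = lineint R r (iter (size qs) (lineint R 0) P).
Proof.
move=> mP P0; elim: qs q r => [|q' qs ih] q r; rewrite big_cons.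
  rewrite big_nil addr0 => /eqP; rewrite eqf_sqr => /orP[]/eqP->; first by [].
  by rewrite /= lineintN.
have s0 : 0 <= \sum_(x <- q' :: qs) x ^+ 2 by apply: sumr_ge0 => i _; exact: sqr_ge0.
set s := \sum_(x <- q' :: qs) x ^+ 2 in s0 * => rE.
have sE : (Num.sqrt s) ^+ 2 = s by rewrite sqr_sqrtr.
have -> : foldr (@lineint R) P [:: q, q' & qs] =
  lineint R q (foldr (@lineint R) P (q' :: qs)) by [].
rewrite (ih q' (Num.sqrt s) sE) (lineint_rotate R q (Num.sqrt s) r)//.
- exact: measurable_iter_lineint.
- exact: iter_lineint_ge0.
- by rewrite sE.
Qed.

Lemma integral_itv_cst (a b c : R) : a <= b -> 0 <= c ->
  (\int[leb]_x (if ((a <= x) && (x <= b))%R then c%:E else 0) = (c * (b - a))%:E)%E.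
Proof.
move=> ab c0.
have -> : (fun x => if (a <= x) && (x <= b) then c%:E else 0%E) =
    ((cst c%:E) \_ `[a, b]%classic).
  by apply/funext => x; rewrite /patch mem_setE in_itv.
rewrite -integral_mkcond integral_cst//=. rewrite lebesgue_measure_itv/= lte_fin.
rewrite le_eqVlt in ab; case/orP: ab => [/eqP<-|ab].
  by rewrite ltxx mule0 subrr mulr0.
by rewrite ab -EFinB -EFinM.
Qed.

Lemma integral_ge_on_itv (a b c : R) psi : a <= b -> 0 <= c ->
  (forall x, 0 <= psi x)%E -> (forall x, a <= x <= b -> (c%:E <= psi x)%E) ->
  ((c * (b - a))%:E <= \int[leb]_x psi x)%E.
Proof.
move=> ab c0 psi0 cpsi; rewrite -integral_itv_cst//.
by apply: le_ge0_integral => x _; case: ifPn => // /cpsi.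
Qed.

Lemma integral_le_on_itv (a b c : R) psi : a <= b -> 0 <= c ->
  (forall x, 0 <= psi x)%E ->
  (forall x, (psi x <= if ((a <= x) && (x <= b))%R then c%:E else 0)%E) ->
  (\int[leb]_x psi x <= (c * (b - a))%:E)%E.
Proof.
by move=> ab c0 psi0 cpsi; rewrite -integral_itv_cst//; exact: le_ge0_integral.
Qed.

Lemma eq_integral_neq (r : R) (f g : R -> \bar R) :
  measurable_fun setT f -> measurable_fun setT g ->
  (forall x, x != r -> f x = g x) -> (\int[leb]_x f x = \int[leb]_x g x)%E.
Proof.
move=> mf mg fg.
have mD : measurable ([set: R] `\ r) by exact: measurableD.
rewrite -(@integral_setD1 _ f r setT mD) -?(@integral_setD1 _ g r setT mD).
- by apply: eq_integral => x; rewrite inE/= => -[_ /eqP]; exact: fg.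
- exact: measurable_funS mg.
- exact: measurable_funS mf.
Qed.

Lemma powRD_gt0 (x r s : R) : 0 < x -> x `^ (r + s) = x `^ r * x `^ s.
Proof. by move=> x0; rewrite powRD//; apply/implyP => _; rewrite gt_eqF. Qed.

(** Up to a constant, [pw (m / 2)] is the density of the squared norm in dimension [m]. *)
Definition pw (al s : R) : R := if 0 < s then s `^ (al - 1) else 0.

Lemma pw_ge0 al s : 0 <= pw al s.
Proof. by rewrite /pw; case: ifP => // _; exact: powR_ge0. Qed.

Lemma measurable_pw al : measurable_fun setT (pw al).
Proof. by rewrite /pw; measurability. Qed.

Lemma pwM al x y : 0 < x -> pw al (x * y) = x `^ (al - 1) * pw al y.
Proof.
move=> x0; rewrite /pw pmulr_rgt0//; case: ifPn => y0; last by rewrite mulr0.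
by rewrite powRM// ltW.
Qed.

(* Proved by averaging over dilations against the weight [e], so that only linear
   substitutions and Tonelli's theorem are needed. *)
Lemma integral_comp_sqr : exists2 K : R, 0 < K &
  forall psi, measurable_fun setT psi -> (forall x, 0 <= psi x)%E ->
  (\int[leb]_t psi (t ^+ 2)%R = K%:E * \int[leb]_s ((pw 2^-1 s)%:E * psi s))%E.
Proof.
pose e (x : R) := if (1 <= x) && (x <= 2) then x `^ 2^-1 else 0.
have e0 x : 0 <= e x by rewrite /e; case: ifP => // _; exact: powR_ge0.
have me : measurable_fun setT e by rewrite /e; measurability.
pose a (t : R) := (t ^+ 2) `^ (-1).
have a0 t : 0 <= a t by exact: powR_ge0.
have ma : measurable_fun setT a by rewrite /a; measurability.
have aE t : a t = (t ^+ 2)^-1 by rewrite /a powR_inv1// sqr_ge0.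
(* Since [a] is homogeneous of degree -2, the [t]-integral of [a t * e (a t * x)] is [k] times
   [x^(-1/2)], that is [k * pw 2^-1 x], for [x > 0]. *)
pose k := (\int[leb]_u (a u * e (a u))%:E)%E.
have k0 : (0 < k)%E.
  (* For [u] in [[4/5, 9/10]] the value [u^-2] lies in [[1, 2]], where [e] is at least 1. *)
  have := @integral_ge_on_itv (4 / 5) (9 / 10) 1 (fun u => (a u * e (a u))%:E).
  have h1 : (4 / 5 : R) <= 9 / 10 by lra.
  move=> /(_ h1 ler01) H; apply: lt_le_trans (H _ _).
  - by rewrite lte_fin; lra.
  - by move=> x; rewrite lee_fin mulr_ge0.
  move=> x /andP[x1 x2]; rewrite lee_fin.
  have ax1 : 1 <= a x.
    by rewrite aE -invr1 lef_pV2 ?posrE//; nra.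
  have ax2 : a x <= 2.
    by rewrite aE invf_ple ?posrE//; nra.
  rewrite /e ax1 ax2/= mulr_ege1//.
  by rewrite -[X in X <= _](powRr0 (a x)) ler_powR// invr_ge0.
have kfin : (k < +oo)%E.
  apply: (@le_lt_trans _ _ (4 * (1 - -1))%:E); last exact: ltry.
  apply: integral_le_on_itv => [|//|x|x]; first by lra.
    by rewrite lee_fin mulr_ge0.
  rewrite /e; case: (boolP (_ && _)) => [/andP[ax1 ax2]|_]; last first.
    by rewrite mulr0; case: ifP => // _; rewrite lee_fin.
  have x0 : x != 0 by apply: contraTN ax1 => /eqP ->; rewrite aE expr0n invr0 -ltNge.
  have xx0 : 0 < x ^+ 2 by rewrite exprn_even_gt0.
  have x1 : x ^+ 2 <= 1.
    by move: ax1; rewrite aE -[X in X <= _]invr1 lef_pV2 ?posrE.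
  have -> : (-1 <= x) && (x <= 1).
    by apply/andP; split; nra.
  rewrite lee_fin -[4](_ : 2 * 2 = _); last by ring.
  apply: ler_pM => //; first exact: powR_ge0.
  apply: le_trans ax2; apply: ler1_powR => //; by rewrite invf_le1// ler1n.
exists (fine k); first by rewrite fine_gt0// k0.
move=> psi mpsi psi0.
rewrite fineK ?ge0_fin_numE ?ltW//.
pose A := (\int[leb]_t psi (t ^+ 2)%R)%E.
have A0 : (0 <= A)%E by exact: integral_ge0.
pose eta (x : R) : \bar R := if (1 <= x) && (x <= 2) then 1%:E else 0%E.
have eta0 x : (0 <= eta x)%E by rewrite /eta; case: ifP.
have meta : measurable_fun setT eta by rewrite /eta; measurability.
have F0 (x : R) y : (0 <= (e x)%:E * psi y)%E by rewrite mule_ge0// lee_fin.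
(* [eta] is the indicator of [[1, 2]] and has integral 1. For [x] in this interval, replacing [t] by
   [x^(1/2) * t] in [A] produces the factor [e x]. *)
transitivity (\int[leb]_x (eta x * A))%E.
  rewrite ge0_integralZr// /eta (@integral_itv_cst 1 2 1)//.
  - by rewrite (_ : (1 * (2 - 1) = 1 :> R)%R) ?mul1e//; ring.
  - by rewrite ler1n.
transitivity (\int[leb]_x \int[leb]_t ((e x)%:E * psi (x * t ^+ 2)%R))%E.
  apply: eq_integral => x _; rewrite /eta /e; case: ifPn => [/andP[x1 x2]|_]; last first.
    by rewrite mul0e; under eq_integral do rewrite mul0e; rewrite integral0.
  have x0 : 0 < x by exact: lt_le_trans x1.
  rewrite mul1e /A (@integral_scale _ _ (x `^ 2^-1)) ?powR_gt0//; last by measurability.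
  rewrite ge0_integralZl//; last 2 first.
  - by measurability.
  - by rewrite lee_fin powR_ge0.
  congr (_ * _)%E; apply: eq_integral => t _; congr psi.
  by rewrite exprMn powR12_sqrt ?sqr_sqrtr ?ltW.
rewrite (integral_swap _ (fun z : R * R => (e z.1)%:E * psi (z.1 * z.2 ^+ 2)%R)%E)//=; last first.
  by measurability.
transitivity (\int[leb]_t \int[leb]_x ((a t * e (a t * x))%:E * psi x))%E.
  apply: (@eq_integral_neq 0).
  - apply: (measurable_integral_snd _ (fun z : R * R => (e z.2)%:E * psi (z.2 * z.1 ^+ 2)%R)%E) => //.
    by measurability.
  - apply: (measurable_integral_snd _ (fun z : R * R => (a z.1 * e (a z.1 * z.2))%:E * psi z.2)%E).
      by measurability.
    by move=> z; rewrite mule_ge0// lee_fin mulr_ge0.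
  move=> t t0; have tt0 : 0 < t ^+ 2 by rewrite exprn_even_gt0.
  have at0 : 0 < a t by rewrite aE invr_gt0.
  rewrite [LHS](@integral_scale _ _ (a t))//; last by measurability.
  rewrite -ge0_integralZl//; last 2 first.
  - by measurability.
  - by rewrite lee_fin.
  apply: eq_integral => x _; rewrite muleA -EFinM; congr (_ * psi _)%E.
  by rewrite aE mulrAC mulVf ?mul1r// gt_eqF.
rewrite (integral_swap _ (fun z : R * R => (a z.1 * e (a z.1 * z.2))%:E * psi z.2)%E)/=; last 2 first.
- by measurability.
- by move=> z; rewrite mule_ge0// lee_fin mulr_ge0.
rewrite -ge0_integralZl//; last 3 first.
- by apply: emeasurable_funM => //; apply/measurable_EFinP; exact: measurable_pw.
- by move=> x _; rewrite mule_ge0// lee_fin pw_ge0.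
- exact: ltW.
apply: eq_integral => x _.
rewrite ge0_integralZr//; last 2 first.
- by measurability.
- by move=> t _; rewrite lee_fin mulr_ge0.
rewrite [RHS]muleA; apply: (congr1 (fun z => z * psi x)%E).
rewrite /pw; case: ifPn => x0; last first.
  rewrite mule0 integral0_eq// => t _; rewrite /e ifF ?mulr0//.
  apply/negbTE; rewrite negb_and -ltNge (@le_lt_trans _ _ 0)//.
  by rewrite mulr_ge0_le0// leNgt.
rewrite (@integral_scale _ _ (x `^ 2^-1)) ?powR_gt0//; last 2 first.
- by measurability.
- by move=> t; rewrite lee_fin mulr_ge0.
have -> : (x `^ (2^-1 - 1) = x `^ 2^-1 * x^-1)%R.
  by rewrite powRD_gt0// powR_inv1 ?ltW.
rewrite [RHS]muleC EFinM -muleA; congr (_ * _)%E.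
rewrite /k -ge0_integralZl//; last 3 first.
- by measurability.
- by move=> t _; rewrite lee_fin mulr_ge0.
- by rewrite lee_fin invr_ge0 ltW.
apply: eq_integral => t _; rewrite -EFinM.
have -> : a (x `^ 2^-1 * t) = x^-1 * a t.
  by rewrite !aE exprMn powR12_sqrt ?sqr_sqrtr ?ltW// invfM.
by rewrite (mulrAC x^-1 (a t) x) mulVf ?gt_eqF// mul1r mulrA.
Qed.

(** The integrability of [s^(-1/2)] at 0: the substitution [s = t^2] turns the integral into a
    multiple of the length of []-1, 1[]. *)
Lemma integral_pw12_lt1 :
  (\int[leb]_s (if s < 1 then pw 2^-1 s else 0)%R%:E < +oo)%E.
Proof.
have [K K0 HK] := integral_comp_sqr.
have := HK (fun s => if s < 1 then 1%E else 0%E).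
have -> : (fun s => (pw 2^-1 s)%:E * (if (s < 1)%R then 1 else 0))%E =
  (fun s => (if s < 1 then pw 2^-1 s else 0)%R%:E).
  by apply/funext => s; case: ifP => _; rewrite ?mule1 ?mule0.
pose I := (\int[leb]_s (if s < 1 then pw 2^-1 s else 0)%R%:E)%E.
rewrite -/I => H.
have I0 : (0 <= I)%E.
  by apply: integral_ge0 => s _; rewrite lee_fin; case: ifP => // _; exact: pw_ge0.
have : (K%:E * I < +oo)%E.
  rewrite -H; first last.
  - by move=> x; case: ifP.
  - by measurability.
  apply: (@le_lt_trans _ _ (1 * (1 - -1))%:E); last exact: ltry.
  apply: integral_le_on_itv => [|//|x|x]; first by lra.
    by case: ifP.
  case: ifPn => x1; last by case: ifP.
  by rewrite ifT//; apply/andP; split; nra.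
move: I0; clear H; case: I => [i _ _|_|//]; first exact: ltry.
by rewrite gt0_muley ?lte_fin.
Qed.

(* The constant is the beta integral [B(1/2, al)]. *)
Lemma pw_convolution (al : R) : 2^-1 <= al -> exists2 B : R, 0 < B &
  forall psi, measurable_fun setT psi -> (forall x, 0 <= psi x)%E ->
  (\int[leb]_r ((pw 2^-1 r)%:E * \int[leb]_s ((pw al s)%:E * psi (r + s)%R)) =
   B%:E * \int[leb]_x ((pw (al + 2^-1) x)%:E * psi x))%E.
Proof.
move=> al12.
have mpw := measurable_pw.
pose k := (\int[leb]_r (pw 2^-1 r * pw al (1 - r))%:E)%E.
have k0 : (0 < k)%E.
  have c0 : 0 < (2^-1 : R) `^ al by rewrite powR_gt0// invr_gt0.
  have := @integral_ge_on_itv (1 / 4) (1 / 2) ((2^-1) `^ al) (fun r => (pw 2^-1 r * pw al (1 - r))%:E).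
  have h1 : (1 / 4 : R) <= 1 / 2 by lra.
  move=> /(_ h1 (ltW c0)) H; apply: lt_le_trans (H _ _).
  - by rewrite lte_fin mulr_gt0//; lra.
  - by move=> x; rewrite lee_fin mulr_ge0 ?pw_ge0.
  move=> x /andP[x1 x2]; rewrite lee_fin /pw ifT; last by lra.
  rewrite ifT; last by lra.
  rewrite -[X in X <= _]mul1r; apply: ler_pM; [exact: ler01|exact: ltW| |].
  - rewrite -[X in X <= _](powRr0 x) ger_powR//; lra.
  - apply: (@le_trans _ _ ((1 - x) `^ al)).
      by apply: ge0_ler_powR => //; rewrite ?nnegrE; lra.
    by apply: ger_powR; lra.
have kfin : (k < +oo)%E.
  have I := integral_pw12_lt1.
  pose f s : R := if s < 1 then pw 2^-1 s else 0.
  have f0 s : 0 <= f s by rewrite /f; case: ifP => // _; exact: pw_ge0.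
  have mf : measurable_fun setT f by rewrite /f; measurability.
  (* The factor [pw 2^-1 r] is singular at 0 only and [pw al (1 - r)] at most at 1. On the half of
     []0, 1[] away from its end point each factor is at most 2, and on the other half it is at most
     [f r], resp. [f (1 - r)]. *)
  apply: (@le_lt_trans _ _ (\int[leb]_r (2%:E * ((f r)%:E + (f (1 - r))%:E))))%E.
    apply: le_ge0_integral => r _; first by rewrite lee_fin mulr_ge0 ?pw_ge0.
    rewrite -EFinD -EFinM lee_fin /f /pw.
    case: (ltP 0 r) => r0; last first.
      rewrite mul0r mulr_ge0// addr_ge0//; case: ifP => //; case: ifP => // *.
      exact: powR_ge0.
    case: (ltP 0 (1 - r)) => r1; last first.
      by rewrite mulr0 mulr_ge0// addr_ge0//; case: ifP => // *; exact: powR_ge0.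
    rewrite ifT; last by lra.
    rewrite ifT; last by lra.
    set A := r `^ _; set B := (1 - r) `^ (2^-1 - 1).
    have A0 : 0 <= A by exact: powR_ge0.
    have B0 : 0 <= B by exact: powR_ge0.
    have inv2 (x : R) : 1 / 2 <= x -> x^-1 <= 2 by move=> ?; rewrite invf_ple ?posrE; lra.
    case: (lerP r (1 / 2)) => r2.
      apply: (@le_trans _ _ (A * 2)); last by nra.
      apply: ler_wpM2l => //; apply: (@le_trans _ _ ((1 - r) `^ (-1))).
        by apply: ger_powR; lra.
      by rewrite powR_inv1; [apply: inv2; lra|lra].
    apply: (@le_trans _ _ (2 * B)); last by nra.
    apply: ler_pM => //; first exact: powR_ge0.
      apply: (@le_trans _ _ (r `^ (-1))).
        by apply: ger_powR; lra.
      by rewrite powR_inv1; [apply: inv2; lra|lra].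
    by apply: ger_powR; lra.
  have mf1 : measurable_fun setT (fun r : R => (f (1 - r))%:E) by measurability.
  have mf2 : measurable_fun setT (fun r : R => (f r)%:E) by measurability.
  rewrite ge0_integralZl//; last 2 first.
  - by apply: emeasurable_funD.
  - by move=> x _; rewrite adde_ge0// lee_fin.
  rewrite ge0_integralD//; last 2 first.
  - by move=> x _; rewrite lee_fin.
  - by move=> x _; rewrite lee_fin.
  have <- : (\int[leb]_x (f x)%:E = \int[leb]_x (f (1 - x))%:E)%E.
    rewrite (@integral_affine _ _ (-1) 1) ?oppr_eq0 ?oner_eq0//.
    rewrite normrN normr1 mul1e; apply: eq_integral => x _; congr (f _)%:E.
    by ring.
  pose I' := (\int[leb]_x (f x)%:E)%E; rewrite -/I'.
  have : I' \is a fin_num.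
    by rewrite ge0_fin_numE//; apply: integral_ge0 => x _; rewrite lee_fin.
  by move=> /fineK <-; rewrite -EFinD -EFinM ltry.
exists (fine k); first by rewrite fine_gt0// k0.
move=> psi mpsi psi0; rewrite fineK ?ge0_fin_numE ?ltW//.
pose F r x := ((pw 2^-1 r * pw al (x - r))%:E * psi x)%E.
have F0 r x : (0 <= F r x)%E by rewrite mule_ge0// lee_fin mulr_ge0// pw_ge0.
have m1 := mpw 2^-1; have m2 := mpw al; have m3 := mpw (al + 2^-1).
transitivity (\int[leb]_r \int[leb]_x F r x)%E.
  apply: eq_integral => r _.
  rewrite [X in (_ * X)%E](@integral_shift _ _ (- r)); last 2 first.
  - by measurability.
  - by move=> x; rewrite mule_ge0// lee_fin pw_ge0.
  rewrite -ge0_integralZl//; last 3 first.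
  - by measurability.
  - by move=> x _; rewrite mule_ge0// lee_fin pw_ge0.
  - by rewrite lee_fin pw_ge0.
  by apply: eq_integral => x _; rewrite /F EFinM -muleA (addrC r) subrK.
rewrite (integral_swap _ (fun z : R * R => F z.1 z.2))//=; last first.
  by rewrite /F; measurability.
rewrite -ge0_integralZl//; last 3 first.
- by measurability.
- by move=> x _; rewrite mule_ge0// lee_fin pw_ge0.
- exact: ltW.
apply: eq_integral => x _.
rewrite ge0_integralZr//; last 2 first.
- by measurability.
- by move=> t _; rewrite lee_fin mulr_ge0// pw_ge0.
rewrite [RHS]muleA; apply: (congr1 (fun z => z * psi x)%E).
rewrite {3}/pw; case: ifPn => x0; last first.
  rewrite mule0 integral0_eq// => r _; rewrite /pw.
  case: (ltP 0 r) => r0; last by rewrite mul0r.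
  by rewrite ifF ?mulr0//; apply/negbTE; rewrite -leNgt; move: x0; rewrite -leNgt; lra.
rewrite [LHS](@integral_scale _ _ x)//; last 2 first.
- by measurability.
- by move=> r; rewrite lee_fin mulr_ge0// pw_ge0.
have -> : (al + 2^-1 - 1 = 1 + (2^-1 - 1) + (al - 1))%R by ring.
rewrite (powRD_gt0 x (1 + (2^-1 - 1)) (al - 1) x0) (powRD_gt0 x 1 (2^-1 - 1) x0).
rewrite powRr1 ?ltW// -mulrA EFinM [RHS]muleC -muleA.
apply: (congr1 (fun z => x%:E * z)%E).
rewrite /k -ge0_integralZl//; last 3 first.
- by measurability.
- by move=> r _; rewrite lee_fin mulr_ge0// pw_ge0.
- by rewrite lee_fin mulr_ge0 ?powR_ge0.
apply: eq_integral => r _; rewrite -EFinM pwM//.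
have -> : x - x * r = x * (1 - r) by ring.
by rewrite pwM// mulrACA.
Qed.

(** Polar coordinates in [m.+1] dimensions: each further direction raises the order of [pw] by 1/2
    through [pw_convolution]. *)
Lemma iter_lineint0 m : exists2 K : R, 0 < K &
  forall P, measurable_fun setT P -> (forall z, 0 <= P z)%E -> forall a b,
  (iter m.+1 (lineint R 0) P (a, b) =
   K%:E * \int[leb]_s ((pw (m.+1%:R / 2) s)%:E * P (a + s, b)%R))%E.
Proof.
have [K1 K10 HK1] := integral_comp_sqr.
have base P : measurable_fun setT P -> (forall z, 0 <= P z)%E -> forall a b,
    (lineint R 0 P (a, b) = K1%:E * \int[leb]_s ((pw 2^-1 s)%:E * P (a + s, b)%R))%E.
  move=> mP P0 a b; rewrite -(HK1 (fun s => P (a + s, b))) //; last by measurability.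
  by apply: eq_integral => t _; rewrite /= mulr0 addr0.
elim: m => [|m [K K0 HK]].
  exists K1; first exact: K10.
  by rewrite -(div1r 2) in base; exact: base.
have m12 : 2^-1 <= m.+1%:R / 2 :> R.
  by rewrite -[X in X <= _]mul1r ler_wpM2r// ?invr_ge0// ler1n.
have [B B0 HB] := pw_convolution _ m12.
exists (K1 * (K * B)); first by rewrite !mulr_gt0.
move=> P mP P0 a b.
rewrite [LHS](base (iter m.+1 (lineint R 0) P)); last 2 first.
- exact: (measurable_iter_lineint R m.+1 0 P mP P0).
- exact: (iter_lineint_ge0 R m.+1 0 P P0).
rewrite EFinM -muleA; apply: (congr1 (fun z => K1%:E * z)%E).
have mpw := measurable_pw (m.+1%:R / 2); have mpw2 := measurable_pw 2^-1.
transitivity (\int[leb]_r (K%:E * ((pw 2^-1 r)%:E *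
    \int[leb]_s ((pw (m.+1%:R / 2) s)%:E * P (a + (r + s), b)%R))))%E.
  apply: eq_integral => r _; rewrite HK// muleCA; do 2 apply: (congr1 (fun z => _ * z)%E).
  by apply: eq_integral => s _; rewrite addrA.
rewrite ge0_integralZl//; last 3 first.
- apply: emeasurable_funM; first by measurability.
  apply: (measurable_integral_snd _ (fun z : R * R => (pw (m.+1%:R / 2) z.2)%:E * P (a + (z.1 + z.2), b)%R)%E).
    by measurability.
  by move=> z; rewrite mule_ge0// lee_fin pw_ge0.
- move=> r _; rewrite mule_ge0// ?lee_fin ?pw_ge0//.
  by apply: integral_ge0 => s _; rewrite mule_ge0// lee_fin pw_ge0.
- by rewrite lee_fin ltW.
rewrite EFinM -muleA; apply: (congr1 (fun z => K%:E * z)%E).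
rewrite (_ : m.+2%:R / 2 = m.+1%:R / 2 + 2^-1); last first.
  by rewrite -[m.+2%:R]natr1 mulrDl mul1r.
apply: (HB (fun s => P (a + s, b))); last by move=> x; exact: P0.
by measurability.
Qed.

End Radial.

(** * Reduction of the cone formula to one variable *)

Section Polar.
Variable R : realType.
Notation leb := (@lebesgue_measure R).
Implicit Types (H : R -> \bar R).

(** The integrand of the cone formula in terms of the squared norm [z.1] and the last coordinate
    [z.2]; the argument of [H] is the absolute value of the last coordinate after normalization. *)
Definition conefun H (z : R * R) : \bar R :=
  if (0 < z.1) && (z.1 <= 1) then H (`|z.2| * z.1 `^ (- 2^-1)) else 0%E.

Lemma conefun_ge0 H : (forall x, 0 <= H x)%E -> forall z, (0 <= conefun H z)%E.
Proof. by move=> H0 z; rewrite /conefun; case: ifP. Qed.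

Lemma measurable_conefun H : measurable_fun setT H -> measurable_fun setT (conefun H).
Proof. by move=> mH; rewrite /conefun; measurability. Qed.

(* Up to a constant, the density of the surface measure of a sphere of dimension
   [2 * al] in the variable [x = tan^2 r], [r] the distance to a fixed point. *)
Definition capdens (al x : R) : R := pw R al x * (1 + x) `^ (- (al + 2^-1)).

Lemma capdens_ge0 al x : 0 <= capdens al x.
Proof. by rewrite mulr_ge0 ?pw_ge0 ?powR_ge0. Qed.

Lemma measurable_capdens al : measurable_fun setT (capdens al).
Proof. by have mpw := measurable_pw R al; rewrite /capdens; measurability. Qed.

(** With [s = t^2 * x] the argument of [H] becomes [c * (1 + x)^(-1/2)], free of [t]. What remains
    is the integral of [|t|^(2 al)] over [t^2 * (1 + x) <= 1], a multiple of
    [(1 + x)^(-(al + 1/2))]. *)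
Lemma lineint_conefun (al : R) : 0 <= al -> exists2 M : R, 0 < M &
  forall H (c : R), measurable_fun setT H -> (forall x, 0 <= H x)%E -> 0 <= c ->
  (lineint R c (fun ab => \int[leb]_s ((pw R al s)%:E * conefun H (ab.1 + s, ab.2)%R)) (0, 0)%R =
   M%:E * \int[leb]_x ((capdens al x)%:E * H (c * (1 + x) `^ (- 2^-1))%R))%E.
Proof.
move=> al0.
have mpw := measurable_pw R al.
pose b (t : R) : R := if t ^+ 2 <= 1 then (t ^+ 2) `^ al else 0.
have b0 t : 0 <= b t by rewrite /b; case: ifP => // _; exact: powR_ge0.
have mb : measurable_fun setT b by rewrite /b; measurability.
pose k := (\int[leb]_t (b t)%:E)%E.
have k0 : (0 < k)%E.
  have c0 : 0 < (4^-1 : R) `^ al by rewrite powR_gt0// invr_gt0.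
  have h1 : (1 / 2 : R) <= 1 by lra.
  have := @integral_ge_on_itv R (1 / 2) 1 (4^-1 `^ al) (fun t => (b t)%:E) h1 (ltW c0).
  move=> HH; apply: lt_le_trans (HH _ _).
  - by rewrite lte_fin mulr_gt0//; lra.
  - by move=> x; rewrite lee_fin.
  move=> x /andP[x1 x2]; rewrite lee_fin /b ifT; last by nra.
  by apply: ge0_ler_powR => //; rewrite ?nnegrE; nra.
have kfin : (k < +oo)%E.
  apply: (@le_lt_trans _ _ (1 * (1 - -1))%:E); last exact: ltry.
  apply: integral_le_on_itv => [|//|x|x]; first by lra.
    by rewrite lee_fin.
  rewrite /b; case: ifPn => x1; last by case: ifP.
  have -> : (-1 <= x) && (x <= 1) by apply/andP; split; nra.
  rewrite lee_fin (@le_trans _ _ (1 `^ al))//; last by rewrite powR1.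
  by apply: ge0_ler_powR => //; rewrite nnegrE ?sqr_ge0.
exists (fine k); first by rewrite fine_gt0// k0.
move=> H c mH H0 c0; rewrite fineK ?ge0_fin_numE ?ltW//.
have mcone := measurable_conefun H mH; have cone0 := conefun_ge0 H H0.
pose F t x : \bar R := (((t ^+ 2) `^ al * pw R al x)%:E *
  if (t ^+ 2 * (1 + x) <= 1)%R then H (c * (1 + x) `^ (- 2^-1))%R else 0)%E.
have F0 t x : (0 <= F t x)%E.
  by rewrite /F mule_ge0// ?lee_fin ?mulr_ge0 ?powR_ge0 ?pw_ge0//; case: ifP.
have mF : measurable_fun setT (fun z : R * R => F z.1 z.2) by rewrite /F; measurability.
have mFt t : measurable_fun setT (F t) by rewrite /F; measurability.
transitivity (\int[leb]_t \int[leb]_x F t x)%E.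
  apply: (@eq_integral_neq R 0).
  - apply: (measurable_integral_snd _ (fun z : R * R => (pw R al z.2)%:E *
      conefun H (0 + z.1 ^+ 2 + z.2, 0 + z.1 * c)%R)%E).
      by measurability.
    by move=> z; rewrite mule_ge0// lee_fin pw_ge0.
  - exact: (measurable_integral_snd _ (fun z : R * R => F z.1 z.2)).
  move=> t t0; have tt0 : 0 < t ^+ 2 by rewrite exprn_even_gt0.
  rewrite [LHS](@integral_scale R _ (t ^+ 2))//=; last 2 first.
  - by measurability.
  - by move=> x; rewrite mule_ge0// lee_fin pw_ge0.
  rewrite -ge0_integralZl//; last 3 first.
  - by measurability.
  - by move=> x _; rewrite mule_ge0// lee_fin pw_ge0.
  - by rewrite lee_fin ltW.
  apply: eq_integral => x _; rewrite muleA -EFinM pwM// mulrA /F.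
  have -> : t ^+ 2 * (t ^+ 2) `^ (al - 1) = (t ^+ 2) `^ al.
    by rewrite -[X in X * _](powRr1 (ltW tt0)) -powRD_gt0// addrC subrK.
  have [x0|x0] := ltP 0 x; last by rewrite /pw ltNge x0/= mulr0 !mul0e.
  apply: (congr1 (fun z => _ * z)%E).
  rewrite /conefun/= !add0r.
  have -> : t ^+ 2 + t ^+ 2 * x = t ^+ 2 * (1 + x) by ring.
  have x10 : 0 < 1 + x by lra.
  rewrite mulr_gt0//=; case: ifP => // _; congr H.
  rewrite powRM ?ltW// normrM (ger0_norm c0) mulrACA mulrC.
  rewrite [X in _ * X](_ : _ = 1) ?mulr1//.
  by rewrite powRN powR12_sqrt ?ltW// sqrtr_sqr divff// normr_eq0.
rewrite (integral_swap _ (fun z : R * R => F z.1 z.2))//=.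
have mcd := measurable_capdens al.
rewrite -ge0_integralZl//; last 3 first.
- by measurability.
- by move=> x _; rewrite mule_ge0// lee_fin capdens_ge0.
- exact: ltW.
apply: eq_integral => x _.
have [x0|x0] := ltP 0 x; last first.
  rewrite /capdens /pw ltNge x0/= mul0r mul0e mule0 integral0_eq// => t _.
  by rewrite /F /pw ltNge x0/= mulr0 mul0e.
have x10 : 0 < 1 + x by lra.
set h := H _.
pose d := (1 + x) `^ (- 2^-1).
have d0 : 0 < d by rewrite powR_gt0.
have d2 : d ^+ 2 = (1 + x)^-1.
  by rewrite /d powRN powR12_sqrt ?ltW// exprVn sqr_sqrtr ?ltW.
transitivity (\int[leb]_t ((pw R al x)%:E * h * (if t ^+ 2 * (1 + x) <= 1 then (t ^+ 2) `^ al else 0)%R%:E))%E.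
  apply: eq_integral => t _; rewrite /F -/h; case: ifP => _; last by rewrite !mule0.
  by rewrite mulrC EFinM -!muleA [(_%:E * h)%E]muleC.
have ph0 : (0 <= (pw R al x)%:E * h)%E by rewrite mule_ge0// ?lee_fin ?pw_ge0// H0.
rewrite ge0_integralZl//; last 2 first.
- by measurability.
- by move=> t _; rewrite lee_fin; case: ifP => // _; exact: powR_ge0.
rewrite [X in (_ * X)%E](@integral_scale R _ d)//; last 2 first.
- by measurability.
- by move=> t; rewrite lee_fin; case: ifP => // _; exact: powR_ge0.
rewrite [X in (_ * (_ * X))%E](_ : _ = ((1 + x) `^ (- al))%:E * k)%E; last first.
  rewrite /k -ge0_integralZl//; last 3 first.
  - by measurability.
  - by move=> t _; rewrite lee_fin.
  - by rewrite lee_fin powR_ge0.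
  apply: eq_integral => t _; rewrite -EFinM /b exprMn d2.
  have -> : (1 + x)^-1 * t ^+ 2 * (1 + x) = t ^+ 2 by field; rewrite gt_eqF.
  case: ifP => _; last by rewrite mulr0.
  by rewrite powRM ?sqr_ge0 ?invr_ge0 ?ltW// -powR_inv1 ?ltW// -powRrM mulN1r.
rewrite /capdens opprD powRD_gt0// -/d.
rewrite !EFinM [RHS]muleC -!muleA; apply: (congr1 (fun z => _ * z)%E).
by rewrite [LHS]muleCA [X in (_ * X = _)%E]muleCA [LHS]muleCA.
Qed.

End Polar.

(** * Integrals over subspheres and the distance to the pole *)

Section SphereIntegrals.
Variable R : realType.
Notation leb := (@lebesgue_measure R).
Implicit Types (H : R -> \bar R).

(** Of the [m.+2] orthonormal directions one carries the whole coordinate [l], namely the norm of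
    the column [l] of [Q]; the other [m.+1] yield the order [m.+1 / 2]. *)
Lemma iterint_conefun m : exists2 K : R, 0 < K &
  forall N (l : 'I_N) (G : 'M[R]_(m.+2, N)), row_free G ->
  exists (Q : 'M[R]_(m.+2, N)) (T : 'M[R]_m.+2),
    [/\ G = T *m Q, Q *m Q^T = 1%:M, 0 < \det T &
     forall H, measurable_fun setT H -> (forall x, 0 <= H x)%E ->
      (iterint (fun v : 'rV[R]_m.+2 => conefun R H (sqn R N (v *m G), (v *m G) ord0 l)) =
      (K / \det T)%R%:E * \int[leb]_x ((capdens R (m.+1%:R / 2) x)%:E *
        H (Num.sqrt (\sum_i Q i l ^+ 2) * (1 + x) `^ (- 2^-1))%R))%E].
Proof.
have [K K0 HK] := iter_lineint0 R m.
have m0 : 0 <= m.+1%:R / 2 :> R by rewrite mulr_ge0 ?invr_ge0.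
have [M M0 HM] := lineint_conefun R _ m0.
exists (K * M); first exact: mulr_gt0.
move=> N l G Gfree.
have [Q [T [qs [GE QQ T0 [sqs sumqs] IH]]]] := iterint_gram_schmidt R N l _ G Gfree.
exists Q, T; split => // H mH H0.
have mP := measurable_conefun R H mH; have P0 := conefun_ge0 R H H0.
have := IH (conefun R H) mP P0 0.
have -> : perp R N _ Q 0 = 0 by rewrite /perp !mul0mx subr0.
have -> : sqn R N 0 = 0 by apply/eqP; rewrite sqn_eq0.
rewrite mxE => E.
have -> : (fun v : 'rV[R]_m.+2 => conefun R H (sqn R N (v *m G), (v *m G) ord0 l)) =
  (fun v : 'rV[R]_m.+2 => conefun R H (sqn R N (0 + v *m G), (0 + v *m G) ord0 l)).
  by apply/funext => v; rewrite add0r.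
rewrite E {E}.
set c := Num.sqrt _.
have c2 : c ^+ 2 = \sum_(x <- qs) x ^+ 2.
  by rewrite sumqs sqr_sqrtr// sumr_ge0// => i _; exact: sqr_ge0.
case: qs sqs c2 {sumqs IH} => [//|q qs] [sqs] c2.
rewrite (foldr_lineint R q qs c)// sqs.
have -> : lineint R c (iter m.+1 (lineint R 0) (conefun R H)) (0, 0) =
  lineint R c (fun ab => K%:E * \int[leb]_s ((pw R (m.+1%:R / 2) s)%:E * conefun R H (ab.1 + s, ab.2)%R))%E (0, 0).
  by apply: eq_integral => t _; rewrite HK.
have -> : lineint R c (fun ab => K%:E * \int[leb]_s ((pw R (m.+1%:R / 2) s)%:E * conefun R H (ab.1 + s, ab.2)%R))%E (0, 0) =
  (K%:E * lineint R c (fun ab => \int[leb]_s ((pw R (m.+1%:R / 2) s)%:E * conefun R H (ab.1 + s, ab.2)%R)) (0, 0)%R)%E.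
  rewrite /lineint ge0_integralZl//.
  - have mpw := measurable_pw R (m.+1%:R / 2).
    apply: (measurable_integral_snd _ (fun z : R * R => (pw R (m.+1%:R / 2) z.2)%:E *
      conefun R H (0 + z.1 ^+ 2 + z.2, 0 + z.1 * c)%R)%E).
      by measurability.
    by move=> z; rewrite mule_ge0// lee_fin pw_ge0.
  - by move=> x _; apply: integral_ge0 => s _; rewrite mule_ge0// lee_fin pw_ge0.
  - by rewrite lee_fin ltW.
rewrite HM//; last exact: sqrtr_ge0.
by rewrite !muleA -!EFinM; congr (_%:E * _)%E; ring.
Qed.

Lemma normalize_sphere n (x : 'rV[R]_n.+1) : 0 < enorm x -> sphere ((enorm x)^-1 *: x).
Proof.
move=> x0; rewrite /sphere/= /enorm -/(sqn _ _ _) sqnZ exprVn sqr_sqrtr ?sqn_ge0//.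
by rewrite mulVf ?sqrtr1// gt_eqF// -sqrtr_gt0.
Qed.

Lemma sphere_coord n (x : 'rV[R]_n.+1) i : sphere x -> x ord0 i ^+ 2 <= 1.
Proof.
move=> x1; have <- : sqn R _ x = 1.
  by rewrite -(@sqr_sqrtr _ (sqn _ _ x)) ?sqn_ge0// [Num.sqrt _]x1 expr1n.
by rewrite /sqn (bigD1 i)//= lerDl sumr_ge0// => j _; exact: sqr_ge0.
Qed.

Lemma conefun_sphere n (f : 'rV[R]_n.+1 -> \bar R) H x :
  (forall x, sphere x -> f x = H `|x ord0 ord_max|) ->
  (if (0 < enorm x) && (enorm x <= 1) then f ((enorm x)^-1 *: x) else 0%E) =
  conefun R H (sqn R _ x, x ord0 ord_max).
Proof.
move=> fH; rewrite /conefun/= {1 2}/enorm -/(sqn _ _ _) sqrtr_gt0.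
have -> : (Num.sqrt (sqn R n.+1 x) <= 1) = (sqn R n.+1 x <= 1).
  by rewrite -[X in _ <= X]sqrtr1 ler_sqrt.
case: ifP => // /andP[x0 _].
have ex0 : 0 < enorm x by rewrite /enorm sqrtr_gt0.
rewrite fH; last exact: normalize_sphere.
congr H; rewrite mxE normrM mulrC normfV (gtr0_norm ex0).
by rewrite powRN powR12_sqrt// ltW.
Qed.

Lemma abse_iterint m (f : 'rV[R]_m -> \bar R) :
  (`|iterint f| <= iterint (fun v => `|f v|))%E.
Proof.
elim: m f => [|m ih] f //=.
apply: le_trans (abse_integral_le _ _ _ _) _.
by apply: le_ge0_integral => t _ //; exact: ih.
Qed.

Lemma abse_radon n k (G : 'M[R]_(k.+1, n.+1)) f :
  (`|radon G f| <= radon G (fun x => `|f x|%R))%E.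
Proof.
rewrite /radon abseM gee0_abs; last by rewrite -EFinM lee_fin mulr_ge0// sqrtr_ge0.
apply: lee_wpmul2l; first by rewrite -EFinM lee_fin mulr_ge0// sqrtr_ge0.
apply: le_trans (abse_iterint _ _) _.
suff -> : (fun v => `|let x := v *m G in
     if (0 < enorm x)%R && (enorm x <= 1)%R then (f ((enorm x)^-1 *: x))%:E else 0|)%E =
  (fun v => let x := v *m G in
     if (0 < enorm x)%R && (enorm x <= 1)%R then (`|f ((enorm x)^-1 *: x)|%R)%:E else 0)%E.
  by [].
by apply/funext => v /=; case: ifP => _; rewrite ?abse0.
Qed.

(** The points of [xi G] are the [z *m Q] with [z] of norm 1, and their last coordinate is the
    scalar product of [z] with the last column of [Q]. Its maximum is the norm [c] of this column,
    and [acos] is decreasing. *)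
Lemma dist0_gram_schmidt n k (G Q : 'M[R]_(k.+1, n.+1)) (T : 'M[R]_k.+1) :
  G = T *m Q -> Q *m Q^T = 1%:M -> 0 < \det T ->
  let c := Num.sqrt (\sum_i Q i ord_max ^+ 2) in
  [/\ dist0 G = acos c, c <= 1 & cos (dist0 G) = c].
Proof.
move=> GE QQ T0 c.
have Tu : T \in unitmx by rewrite unitmxE unitfE gt_eqF.
pose q : 'rV[R]_k.+1 := \row_i Q i ord_max.
have cE : c = Num.sqrt (sqn R _ q).
  by congr Num.sqrt; apply: eq_bigr => i _; rewrite mxE.
have c2 : c ^+ 2 = sqn R _ q by rewrite cE sqr_sqrtr// sqn_ge0.
have c0 : 0 <= c by exact: sqrtr_ge0.
have sqnQ z : sqn R _ (z *m Q) = sqn R _ z.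
  by rewrite !sqnE /dotr trmx_mul mulmxA -(mulmxA z) QQ mulmx1.
have zQl (z : 'rV[R]_k.+1) : (z *m Q) ord0 ord_max = dotr R _ q z.
  by rewrite /dotr !mxE; apply: eq_bigr => i _; rewrite !mxE mulrC.
(* Cauchy-Schwarz, from expanding the squared norm of [q - dotr q z *: z]. *)
have zc z : sqn R _ z = 1 -> dotr R _ q z ^+ 2 <= c ^+ 2.
  move=> z1; rewrite c2.
  have := sqn_ge0 R _ (q + (- dotr R _ q z) *: z).
  rewrite sqnD sqnZ z1 /dotr linearZ/= -scalemxAr mxE -/(dotr R _ q z).
  by set d := dotr _ _ _ _; nra.
have [z z1 zqc] : exists2 z, sqn R _ z = 1 & dotr R _ q z = c.
  (* For [c = 0] every unit vector attains the maximum, otherwise the normalized column does. *)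
  have [c0'|c0'] := eqVneq c 0.
    exists (delta_mx 0 ord0).
      rewrite /sqn (bigD1 ord0)//= mxE !eqxx/= expr1n big1 ?addr0// => i i0.
      by rewrite mxE (negbTE i0) andbF expr0n.
    move/eqP: (c2); rewrite c0' expr0n/= eq_sym sqn_eq0 => /eqP ->.
    by rewrite /dotr mul0mx mxE.
  exists (c^-1 *: q); first by rewrite sqnZ -c2 exprVn mulVf// sqrf_eq0.
  rewrite /dotr linearZ/= -scalemxAr mxE -/(dotr R _ q q) -sqnE -c2.
  by rewrite expr2 mulrA mulVf// mul1r.
have c1 : c <= 1.
  have : c ^+ 2 <= 1.
    rewrite -zqc -zQl; apply: sphere_coord.
    by rewrite /sphere/= /enorm -/(sqn _ _ _) sqnQ z1 sqrtr1.
  by move=> ?; nra.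
have cI : c \in `[(-1), 1] by rewrite in_itv/=; lra.
suff dE : dist0 G = acos c by split => //; rewrite dE acosK.
pose S := [set d0 x | x in xi G].
have Sc : S (acos c).
  exists (z *m Q); last by rewrite /d0 zQl zqc.
  split; first by rewrite /sphere/= /enorm -/(sqn _ _ _) sqnQ z1 sqrtr1.
  by exists (z *m invmx T); rewrite GE mulmxA mulmxKV.
have lbS : lbound S (acos c).
  move=> _ [x [x1 [y xE]] <-]; rewrite /d0.
  have xE' : x = (y *m T) *m Q by rewrite xE GE mulmxA.
  have sx : sqn R _ (y *m T) = 1.
    rewrite -sqnQ -xE' -(@sqr_sqrtr _ (sqn R _ x)) ?sqn_ge0//.
    by rewrite [Num.sqrt _]x1 expr1n.
  have xc := zc _ sx; rewrite -zQl -xE' in xc.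
  have xl : x ord0 ord_max <= c by nra.
  have xl1 : -1 <= x ord0 ord_max by nra.
  rewrite leNgt; apply/negP => lt.
  have : cos (acos c) < cos (acos (x ord0 ord_max)).
    rewrite ltr_cos//.
    - by rewrite in_itv/= acos_ge0 ?acos_lepi//; lra.
    - by rewrite in_itv/= acos_ge0 ?acos_lepi//; lra.
  by rewrite !acosK ?in_itv/=; lra.
apply/eqP; rewrite eq_le; apply/andP; split.
  by apply: ge_inf => //; exists (acos c).
by apply: lb_le_inf => //; exists (acos c).
Qed.

End SphereIntegrals.

(** * One-dimensional formulas for the Radon transform and the weighted measure *)

Section Formulas.
Variable R : realType.
Notation leb := (@lebesgue_measure R).

(** The square root of the Gram determinant of [G] is [\det T], which cancels the factor
    [1 / \det T] left by Gram-Schmidt, so that one constant serves all [G]. The frame [Q] is part of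
    the conclusion in order to relate [c] to Gram determinants later. *)
Lemma radon_formula m : exists2 K : R, 0 < K &
  forall n (G : 'M[R]_(m.+2, n.+1)), row_free G ->
  exists2 c : R, [/\ 0 <= c <= 1, dist0 G = acos c, cos (dist0 G) = c &
    exists Q T, [/\ G = T *m Q, Q *m Q^T = 1%:M, 0 < \det T & c ^+ 2 = \sum_i Q i ord_max ^+ 2]] &
  forall f (F : R -> R), measurable_fun setT F -> (forall t, 0 <= F t) ->
    (forall x, sphere x -> f x = F `|x ord0 ord_max|) ->
    (radon G f = K%:E * \int[leb]_x (capdens R (m.+1%:R / 2) x *
       F (c * (1 + x) `^ (- 2^-1)))%:E)%E.
Proof.
have [K K0 HK] := iterint_conefun R m.
exists (m.+2%:R * K); first by rewrite mulr_gt0.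
move=> n G Gfree; have [Q [T [GE QQ T0 HG]]] := HK _ ord_max G Gfree.
have [dE c1 cE] := dist0_gram_schmidt R n m.+1 G Q T GE QQ T0.
exists (Num.sqrt (\sum_i Q i ord_max ^+ 2)).
  split => //; first by rewrite sqrtr_ge0.
  by exists Q, T; split => //; rewrite sqr_sqrtr// sumr_ge0// => i _; exact: sqr_ge0.
move=> f F mF F0 fF; rewrite /radon.
have -> : \det (G *m G^T) = (\det T) ^+ 2.
  by rewrite GE trmx_mul mulmxA -(mulmxA T) QQ mulmx1 det_mulmx det_tr expr2.
rewrite sqrtr_sqr gtr0_norm//.
have -> : (fun y : 'rV[R]_m.+2 => let x := y *m G in
     if (0 < enorm x) && (enorm x <= 1) then (f ((enorm x)^-1 *: x))%:E else 0%E) =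
  (fun y : 'rV[R]_m.+2 => conefun R (fun t => (F t)%:E) (sqn R _ (y *m G), (y *m G) ord0 ord_max)).
  apply/funext => y /=.
  rewrite -(conefun_sphere R n (fun x => (f x)%:E) (fun t => (F t)%:E))//.
  by move=> x xS; rewrite fF.
rewrite HG; last 2 first.
- by measurability.
- by move=> x; rewrite lee_fin.
rewrite muleA -!EFinM; congr (_%:E * _)%E.
by field; rewrite gt_eqF.
Qed.

(* Up to a constant, the density of the weighted measure [mu a1 a2] in the same
   variable, with [be = (a1 + n) / 2]. *)
Definition capweight (be a2 x : R) : R := pw R be x * (1 + x) `^ (- (be + (1 + a2) / 2)).

Lemma capweight_ge0 be a2 x : 0 <= capweight be a2 x.
Proof. by rewrite mulr_ge0 ?pw_ge0 ?powR_ge0. Qed.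

Lemma measurable_capweight be a2 : measurable_fun setT (capweight be a2).
Proof. by have mpw := measurable_pw R be; rewrite /capweight; measurability. Qed.

(** This is the case of the identity matrix, where [c = 1]. At height [(1 + x)^(-1/2)] the weight is
    [(x / (1 + x))^(a1 / 2) * (1 + x)^(-a2 / 2)], which turns the exponents of [capdens] into those
    of [capweight]. *)
Lemma mu_formula m : exists2 K : R, 0 < K &
  forall (a1 a2 s : R) (f : 'rV[R]_m.+2 -> R) (F : R -> R), measurable_fun setT F ->
    (forall x, sphere x -> f x = F `|x ord0 ord_max|) ->
    (mu a1 a2 [set x | s < `|f x|]%R = K%:E * \int[leb]_x
      (if s < `|F ((1 + x) `^ (- 2^-1))| then capweight ((a1 + m.+1%:R) / 2) a2 x else 0)%R%:E)%E.
Proof.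
have [K K0 HK] := iterint_conefun R m.
have f1 : row_free (1%:M : 'M[R]_m.+2) by rewrite row_free_unit unitmx1.
have [Q [T [GE QQ T0 HG]]] := HK _ ord_max _ f1.
have sumQ : \sum_i Q i ord_max ^+ 2 = 1.
  have := mulmx1C QQ => /matrixP/(_ ord_max ord_max); rewrite !mxE eqxx mulr1n => <-.
  by apply: eq_bigr => i _; rewrite mxE expr2.
exists (m.+2%:R * (K / \det T)); first by rewrite mulr_gt0// divr_gt0.
move=> a1 a2 s f F mF fF; rewrite /mu /sphint.
pose H (t : R) : \bar R :=
  (if s < `|F t| then ((1 - t ^+ 2) `^ 2^-1) `^ a1 * t `^ a2 else 0)%:E.
have mH : measurable_fun setT H by rewrite /H; measurability.
have H0 x : (0 <= H x)%E.
  by rewrite lee_fin; case: ifP => // _; rewrite mulr_ge0 ?powR_ge0.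
have -> : (fun y : 'rV[R]_m.+2 => if (0 < enorm y) && (enorm y <= 1) then
     ((\1_[set x | s < `|f x|] ((enorm y)^-1 *: y) : R) * weight a1 a2 ((enorm y)^-1 *: y))%:E else 0%E) =
  (fun y : 'rV[R]_m.+2 => conefun R H (sqn R _ (y *m 1%:M), (y *m 1%:M) ord0 ord_max)).
  apply/funext => y; rewrite mulmx1.
  rewrite -(conefun_sphere R m.+1 (fun x => ((\1_[set x | s < `|f x|] x : R) * weight a1 a2 x)%:E) H)//.
  move=> x xS; rewrite /H /weight indicE; congr (_%:E).
  have x1 := sphere_coord R _ x ord_max xS.
  have x11 : -1 <= x ord0 ord_max <= 1 by apply/andP; split; nra.
  rewrite -fF//; case: ifPn => h; last first.
    by rewrite memNset ?mul0r//=; exact/negP.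
  rewrite mem_set//= mul1r /d0 sin_acos// acosK ?in_itv//= powR12_sqrt ?real_normK ?num_real//.
  by rewrite subr_ge0.
rewrite HG// sumQ sqrtr1 [LHS]muleA -EFinM; congr (_%:E * _)%E.
apply: eq_integral => x _; rewrite mul1r /H -EFinM; congr (_%:E).
case: ifP => _; last by rewrite mulr0.
have [x0|x0] := ltP 0 x; last by rewrite /capdens /capweight /pw ltNge x0/= !mul0r.
have x10 : 0 < 1 + x by lra.
rewrite /capdens /capweight /pw x0.
have -> : 1 - ((1 + x) `^ (- 2^-1)) ^+ 2 = x * (1 + x)^-1.
  rewrite powRN powR12_sqrt ?ltW// exprVn sqr_sqrtr ?ltW//.
  by field; rewrite gt_eqF.
rewrite -!powRrM powRM ?invr_ge0 ?ltW// -(powR_inv1 (ltW x10)) -powRrM.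
set N := m.+1%:R.
have -> : (a1 + N) / 2 - 1 = (N / 2 - 1) + 2^-1 * a1 by field.
have -> : - ((a1 + N) / 2 + (1 + a2) / 2) =
  - (N / 2 + 2^-1) + (-1 * (2^-1 * a1) + - 2^-1 * a2) by field.
rewrite (powRD_gt0 R x (N / 2 - 1) _ x0) (powRD_gt0 R (1 + x) (- (N / 2 + 2^-1)) _ x10).
rewrite (powRD_gt0 R (1 + x) (-1 * (2^-1 * a1)) _ x10).
by ring.
Qed.

End Formulas.

(** * Mass of the sublevel sets of the comparison function *)

Section Restricted.
Variable R : realType.
Notation leb := (@lebesgue_measure R).

Lemma integralZ_EFin (a : R) (f : R -> R) : 0 <= a -> measurable_fun setT f ->
  (forall x, 0 <= f x) ->
  (\int[leb]_x (a * f x)%:E = a%:E * \int[leb]_x (f x)%:E)%E.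
Proof.
move=> a0 mf f0; under eq_integral do rewrite EFinM.
apply: ge0_integralZl_EFin => //; first by move=> x _; rewrite lee_fin.
by measurability.
Qed.

Lemma integral_scale_EFin (a : R) (f : R -> R) : 0 < a -> measurable_fun setT f ->
  (forall x, 0 <= f x) ->
  (\int[leb]_x (f x)%:E = \int[leb]_x (a * f (a * x))%:E)%E.
Proof.
move=> a0 mf f0; rewrite integralZ_EFin//; first last.
- by measurability.
- exact: ltW.
by apply: integral_scale => //; measurability.
Qed.

Lemma integral_oneDsqrV_lty : (\int[leb]_t ((1 + t ^+ 2)^-1)%R%:E < +oo)%E.
Proof.
have -> : (\int[leb]_t ((1 + t ^+ 2)^-1)%R%:E = \int[leb]_t ((oneDsqr t)^-1)%R%:E)%E by [].
rewrite (@ge0_symfun_integralT R (fun t => (oneDsqr t)^-1)).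
- by rewrite -set_itvcy integral0y_oneDsqr -EFinM ltry.
- by move=> x; rewrite invr_ge0 (le_trans _ (oneDsqr_ge1 x)).
- exact: continuous_oneDsqrV.
- by move=> x; rewrite /= /oneDsqr sqrrN.
Qed.

(** The cut-off [x^e < y] selects a neighbourhood of 0 in the half-line for [e > 0] and one of
    infinity for [e < 0]. *)
Definition pwsub (e y x : R) : R := if x `^ e < y then pw R e x else 0.

Lemma pwsub_ge0 e y x : 0 <= pwsub e y x.
Proof. by rewrite /pwsub; case: ifP => // _; exact: pw_ge0. Qed.

Lemma measurable_pwsub e y : measurable_fun setT (pwsub e y).
Proof. by have mpw := measurable_pw R e; rewrite /pwsub; measurability. Qed.

(** Replacing [x] by [y^(1/e) * x] brings the cut-off to level 1, and [x^(e - 1) dx] has degree [e],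
    hence the factor [y]. *)
Lemma integral_pwsub_scale e y : e != 0 -> 0 < y ->
  (\int[leb]_x (pwsub e y x)%:E = y%:E * \int[leb]_x (pwsub e 1 x)%:E)%E.
Proof.
move=> e0 y0; have ms z := measurable_pwsub e z; have ms1 := ms y; have ms2 := ms 1.
pose a := y `^ e^-1.
have a0 : 0 < a by rewrite powR_gt0.
have ae : a `^ e = y by rewrite -powRrM mulVf// powRr1// ltW.
rewrite (integral_scale_EFin a _ a0 ms1 (pwsub_ge0 e y)).
rewrite -(integralZ_EFin y _ (ltW y0) ms2 (pwsub_ge0 e 1)).
apply: eq_integral => x _; congr (_%:E).
have [x0|x0] := ltP 0 x; last first.
  rewrite /pwsub /pw !ltNge x0/= (_ : (a * x <= 0)%R) ?if_same ?mulr0//.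
  by rewrite mulr_ge0_le0// ltW.
rewrite /pwsub powRM ?ltW// ae -[X in _ < X](mulr1 y) ltr_pM2l//.
case: ifP => _; last by rewrite !mulr0.
rewrite pwM// mulrA; congr (_ * _).
by rewrite -[X in X * _](powRr1 (ltW a0)) -powRD_gt0// addrC subrK.
Qed.

Lemma integral_pwsub1_lty e : 2^-1 <= e \/ e = - 2^-1 ->
  (\int[leb]_x (pwsub e 1 x)%:E < +oo)%E.
Proof.
case=> [e12|->].
  apply: le_lt_trans (integral_pw12_lt1 R).
  apply: le_ge0_integral => x _; rewrite lee_fin ?pwsub_ge0//.
  rewrite /pwsub; case: ifPn => h; last by case: ifP => // _; exact: pw_ge0.
  rewrite /pw; case: ifPn => x0; last by case: ifP.
  have x1 : x < 1.
    rewrite ltNge; apply/negP => x1; move: h; rewrite ltNge => /negP; apply.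
    by rewrite -[X in X <= _](powRr0 x); apply: ler_powR; lra.
  by rewrite x1; apply: ger_powR; lra.
(* For [e = -1/2] the density is [x^(-3/2)] on [x > 1]. It is at most [x^(-1/2) * 2 / (1 + x)],
   which the substitution [x = t^2] compares with the convergent integral of [2 / (1 + t^2)]. *)
have [K K0 HK] := integral_comp_sqr R.
pose psi (u : R) : \bar R := (if 1 < u then 2 * (1 + u) `^ (-1) else 0)%:E.
have psi0 u : (0 <= psi u)%E.
  by rewrite lee_fin; case: ifP => // _; rewrite mulr_ge0// powR_ge0.
have mpsi : measurable_fun setT psi by rewrite /psi; measurability.
have E := HK psi mpsi psi0.
pose I := (\int[leb]_s ((pw R 2^-1 s)%:E * psi s))%E.
apply: (@le_lt_trans _ _ I).
  apply: le_ge0_integral => x _; first by rewrite lee_fin pwsub_ge0.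
  rewrite -EFinM lee_fin /pwsub; case: ifPn => h; last first.
    by rewrite mulr_ge0 ?pw_ge0//; have := psi0 x; rewrite lee_fin.
  rewrite /pw; case: ifPn => x0; last by rewrite mul0r.
  have x1 : 1 < x.
    rewrite ltNge; apply/negP => x1; move: h; rewrite ltNge => /negP; apply.
    by rewrite -[X in X <= _](powRr0 x); apply: ger_powR; lra.
  rewrite x1 powR_inv1; last by lra.
  have -> : - 2^-1 - 1 = (2^-1 - 1) + (-1) :> R by field.
  rewrite (powRD_gt0 R x (2^-1 - 1) _ x0) ler_wpM2l ?powR_ge0// powR_inv1 ?ltW//.
  by rewrite ltr_pdivlMr; [rewrite mulrC ltr_pdivrMr; lra|lra].
have I0 : (0 <= I)%E.
  by apply: integral_ge0 => s _; rewrite mule_ge0// lee_fin pw_ge0.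
have : (K%:E * I < +oo)%E.
  rewrite -E; apply: (@le_lt_trans _ _ (\int[leb]_t (2%:E * ((1 + t ^+ 2)^-1)%R%:E))%E).
    apply: le_ge0_integral => t _ //; rewrite -EFinM lee_fin.
    have t0 := sqr_ge0 t.
    case: ifP => _; last by rewrite mulr_ge0// invr_ge0; lra.
    by rewrite powR_inv1//; lra.
  have mV : measurable_fun setT (fun t : R => ((1 + t ^+ 2)^-1)%:E).
    apply/measurable_EFinP; apply: continuous_measurable_fun.
    exact: continuous_oneDsqrV.
  rewrite ge0_integralZl//; last first.
    by move=> t _; rewrite lee_fin invr_ge0 addr_ge0// sqr_ge0.
  have := integral_oneDsqrV_lty; set J := (\int[leb]_t _)%E => J1.
  have : J \is a fin_num.
    rewrite ge0_fin_numE//; apply: integral_ge0 => t _.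
    by rewrite lee_fin invr_ge0 addr_ge0// sqr_ge0.
  by move=> /fineK <-; rewrite -EFinM ltry.
move: I0; clear E; case: I => [i _ _|_|//]; first exact: ltry.
by rewrite gt0_muley ?lte_fin.
Qed.

(** The comparison function [th], equal to [x * capdens al x]: it behaves like [x^al] at 0 and like
    [x^(-1/2)] at infinity. *)
Definition caplevel (al x : R) : R := pw R (al + 1) x * (1 + x) `^ (- (al + 2^-1)).

Lemma caplevel_ge0 al x : 0 <= caplevel al x.
Proof. by rewrite mulr_ge0 ?pw_ge0 ?powR_ge0. Qed.

Lemma measurable_caplevel al : measurable_fun setT (caplevel al).
Proof. by have mpw := measurable_pw R (al + 1); rewrite /caplevel; measurability. Qed.

Lemma caplevel_le1 al x : 0 <= al -> caplevel al x <= 1.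
Proof.
move=> al0; rewrite /caplevel /pw; case: ifPn => x0; last by rewrite mul0r.
have x10 : 0 < 1 + x by lra.
rewrite addrK powRN ler_pdivrMr ?powR_gt0// mul1r.
apply: (@le_trans _ _ ((1 + x) `^ al)).
  by apply: ge0_ler_powR => //; rewrite ?nnegrE; lra.
by apply: ler_powR; lra.
Qed.

(** Split at [x = 1]. Since [1 + x] is at most 2, resp. at most [2 * x], the condition
    [caplevel al x < y] forces [x^al < D * y], resp. [x^(-1/2) < D * y], while [capdens] is at most
    [pw al], resp. [pw (-1/2)]. By scaling, both restricted integrals are linear in [y]. *)
Lemma capdens_sublevel al : 2^-1 <= al -> exists2 K : R, 0 < K &
  forall y, 0 < y -> (\int[leb]_x (if (caplevel al x < y)%R then (capdens R al x)%:E else 0)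
    <= (K * y)%:E)%E.
Proof.
move=> al12.
pose D := (2 : R) `^ (al + 2^-1).
have D0 : 0 < D by rewrite powR_gt0.
have fin e : 2^-1 <= e \/ e = - 2^-1 -> exists2 M, 0 <= M & (\int[leb]_x (pwsub e 1 x)%:E = M%:E)%E.
  move=> /integral_pwsub1_lty h; exists (fine (\int[leb]_x (pwsub e 1 x)%:E)%E).
    by apply: fine_ge0; apply: integral_ge0 => x _; rewrite lee_fin pwsub_ge0.
  rewrite fineK// ge0_fin_numE//.
  by apply: integral_ge0 => x _; rewrite lee_fin pwsub_ge0.
have [M M0 ME] := fin _ (or_introl al12).
have [M' M'0 M'E] := fin _ (or_intror (erefl (- 2^-1))).
exists (D * M + D * M' + 1); first by rewrite ltr_wpDl// addr_ge0// mulr_ge0// ltW.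
move=> y y0; have Dy0 : 0 < D * y by rewrite mulr_gt0.
have m1 := measurable_pwsub al (D * y); have m2 := measurable_pwsub (- 2^-1) (D * y).
apply: (@le_trans _ _ (\int[leb]_x ((pwsub al (D * y) x)%:E + (pwsub (- 2^-1) (D * y) x)%:E)))%E; last first.
  rewrite ge0_integralD//; first last.
  - by measurability.
  - by move=> x _; rewrite lee_fin pwsub_ge0.
  - by measurability.
  - by move=> x _; rewrite lee_fin pwsub_ge0.
  have al0 : al != 0 by apply: lt0r_neq0; lra.
  have h0 : - 2^-1 != 0 :> R by rewrite oppr_eq0 invr_eq0.
  rewrite (integral_pwsub_scale al (D * y) al0 Dy0).
  rewrite (integral_pwsub_scale (- 2^-1) (D * y) h0 Dy0).
  by rewrite ME M'E -!EFinM -EFinD lee_fin; nra.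
apply: le_ge0_integral => x _; first by case: ifP => // _; rewrite lee_fin capdens_ge0.
rewrite -EFinD; case: ifPn => h; last by rewrite lee_fin addr_ge0// pwsub_ge0.
have [x0|x0] := ltP 0 x; last first.
  by rewrite /capdens /pw ltNge x0/= mul0r lee_fin addr_ge0// pwsub_ge0.
have x10 : 0 < 1 + x by lra.
rewrite lee_fin; move: h; rewrite /caplevel /capdens /pwsub /pw x0 addrK powRN => h.
have [x1|x1] := lerP x 1.
  rewrite -[X in X <= _]addr0 lerD//; last by case: ifP => // _; exact: powR_ge0.
  rewrite ifT; last first.
    rewrite mulrC -ltr_pdivrMr//; apply: le_lt_trans h.
    apply: ler_wpM2l; first exact: powR_ge0.
    rewrite lef_pV2 ?posrE ?powR_gt0//.
    by apply: ge0_ler_powR; rewrite ?nnegrE; lra.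
  rewrite ler_piMr ?powR_ge0// invf_le1 ?powR_gt0//.
  by rewrite -[X in X <= _](powRr0 (1 + x)) ler_powR//; lra.
rewrite -[X in X <= _]add0r lerD//; first by case: ifP => // _; exact: powR_ge0.
rewrite ifT; last first.
  rewrite mulrC -ltr_pdivrMr//; apply: le_lt_trans h.
  rewrite /D ler_pdivlMr ?powR_gt0// mulrAC ler_pdivrMr ?powR_gt0//.
  have -> : x `^ al = x `^ (- 2^-1) * x `^ (al + 2^-1).
    by rewrite -powRD_gt0//; congr (_ `^ _); ring.
  rewrite -mulrA; apply: ler_wpM2l; first exact: powR_ge0.
  rewrite -powRM//; last exact: ltW.
  by apply: ge0_ler_powR; rewrite ?nnegrE; lra.
have -> : - 2^-1 - 1 = (al - 1) - (al + 2^-1) by ring.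
rewrite (powRD_gt0 R x (al - 1) _ x0); apply: ler_wpM2l; first exact: powR_ge0.
rewrite powRN lef_pV2 ?posrE ?powR_gt0//.
by apply: ge0_ler_powR; rewrite ?nnegrE; lra.
Qed.

End Restricted.

(** * The estimate for sets and the sufficiency of the conditions *)

Section Sufficiency.
Variable R : realType.
Notation leb := (@lebesgue_measure R).

(** The powers of [x] on both sides agree. Those of [1 + x >= 1] compare because [(al + 1/2) * p] is
    at least [al * p + (1 + a2) / 2], which is the condition [1 + a2 <= p]. *)
Lemma capweight_ge (al p a2 x : R) : 1 + a2 <= p -> 1 <= p ->
  (caplevel R al x) `^ (p - 1) * capdens R al x <= capweight R (al * p) a2 x.
Proof.
move=> a2p p1; rewrite /capdens /capweight /caplevel /pw.
case: ifPn => x0; last by rewrite !mul0r mulr0.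
have x10 : 0 < 1 + x by lra.
rewrite addrK powRM ?powR_ge0// -!powRrM.
have -> : x `^ (al * (p - 1)) * (1 + x) `^ (- (al + 2^-1) * (p - 1)) *
   (x `^ (al - 1) * (1 + x) `^ (- (al + 2^-1))) =
   (x `^ (al * (p - 1)) * x `^ (al - 1)) *
   ((1 + x) `^ (- (al + 2^-1) * (p - 1)) * (1 + x) `^ (- (al + 2^-1))) by ring.
rewrite -!powRD_gt0//.
have -> : al * (p - 1) + (al - 1) = al * p - 1 by ring.
apply: ler_wpM2l; first exact: powR_ge0.
by apply: ler_powR; lra.
Qed.

(* With [y] proportional to the [capdens]-mass of [E], at least half of this mass
   lies where [caplevel >= y], and there [capweight >= y^(p-1) * capdens]. *)
Lemma capdens_restricted (al p a2 : R) : 2^-1 <= al -> 1 <= p -> 1 + a2 <= p ->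
  exists2 C : R, 0 < C & forall E : R -> bool, measurable_fun setT E ->
  (\int[leb]_x (if E x then capdens R al x else 0)%R%:E <=
   C%:E * (\int[leb]_x (if E x then capweight R (al * p) a2 x else 0)%R%:E) `^ p^-1)%E.
Proof.
move=> al12 p1 a2p; have [K K0 HK] := capdens_sublevel R al al12.
have p0 : 0 < p by lra.
(* Chosen so that [(r / (2 * K))^(p - 1) * (r / 2) = kap * r^p], where [r] will be the
   [capdens]-mass of [E]. *)
pose kap := ((2 * K)^-1) `^ (p - 1) / 2.
have K20 : 0 < (2 * K)^-1 by rewrite invr_gt0 mulr_gt0.
have kap0 : 0 < kap by rewrite divr_gt0// powR_gt0.
exists (kap `^ p^-1)^-1; first by rewrite invr_gt0 powR_gt0.
move=> E mE.
set A := (\int[leb]_x (if E x then capdens R al x else 0)%R%:E)%E.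
set B := (\int[leb]_x _)%E.
have mg := measurable_capdens R al; have mw := measurable_capweight R (al * p) a2.
have mth := measurable_caplevel R al.
have g0 x := capdens_ge0 R al x; have w0 x := capweight_ge0 R (al * p) a2 x.
have A0 : (0 <= A)%E by apply: integral_ge0 => x _; rewrite lee_fin; case: ifP.
have B0 : (0 <= B)%E by apply: integral_ge0 => x _; rewrite lee_fin; case: ifP.
(* As [caplevel] is at most 1, its sublevel set at height 2 is the whole line. *)
have Afin : (A < +oo)%E.
  apply: le_lt_trans (ltry (K * 2)); apply: le_trans (HK 2 _); last by [].
  apply: le_ge0_integral => x _; first by rewrite lee_fin; case: ifP.
  have -> : caplevel R al x < 2 by apply: (@le_lt_trans _ _ 1); [apply: caplevel_le1; lra|lra].
  by rewrite lee_fin; case: ifP.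
have C0 : 0 <= (kap `^ p^-1)^-1 by rewrite invr_ge0 powR_ge0.
have AE : A = (fine A)%:E by rewrite fineK// ge0_fin_numE.
set r := fine A in AE.
have : 0 <= r by exact: fine_ge0.
rewrite le_eqVlt => /predU1P[r0|r0].
  by rewrite AE -r0 mule_ge0// ?lee_fin// poweR_ge0.
pose y := r / (2 * K).
have y0 : 0 < y by rewrite mulr_gt0.
pose X := (\int[leb]_x (if E x && (y <= caplevel R al x) then capdens R al x else 0)%R%:E)%E.
have X2 : ((r / 2)%:E <= X)%E.
  have : (A <= X + (r / 2)%:E)%E.
    apply: (@le_trans _ _ (X + \int[leb]_x (if (caplevel R al x < y)%R then (capdens R al x)%:E else 0)))%E.
      rewrite -ge0_integralD//; first last.
      - by measurability.
      - by move=> x _; case: ifP => // _; rewrite lee_fin.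
      - by measurability.
      - by move=> x _; rewrite lee_fin; case: ifP.
      apply: le_ge0_integral => x _; first by rewrite lee_fin; case: ifP.
      have [h|h] := ltP (caplevel R al x) y.
        by rewrite andbF add0e lee_fin; case: ifP.
      by rewrite andbT adde0.
    rewrite leeD2l//; apply: le_trans (HK y y0) _; rewrite lee_fin /y.
    by rewrite le_eqVlt; apply/orP; left; apply/eqP; field; rewrite gt_eqF.
  rewrite AE -leeBlDr// -EFinB; apply: le_trans; rewrite lee_fin; lra.
have BX : ((r `^ p * kap)%:E <= B)%E.
  apply: (@le_trans _ _ ((y `^ (p - 1))%:E * X)%E).
    apply: (@le_trans _ _ ((y `^ (p - 1))%:E * (r / 2)%:E)%E); last first.
      by apply: lee_wpmul2l; [rewrite lee_fin powR_ge0|exact: X2].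
    rewrite -EFinM lee_fin /y powRM ?(ltW r0) ?(ltW K20)//.
    have -> : r `^ p = r `^ (p - 1) * r.
      by rewrite -[X in _ * X](powRr1 (ltW r0)) -powRD_gt0// subrK.
    by rewrite le_eqVlt /kap; apply/orP; left; apply/eqP; ring.
  rewrite -integralZ_EFin ?powR_ge0//; last 2 first.
  - by measurability.
  - by move=> x; case: ifP.
  apply: le_ge0_integral => x _.
    by rewrite lee_fin mulr_ge0 ?powR_ge0//; case: ifP.
  rewrite lee_fin; case: ifPn => [/andP[-> yth]|_]; last by rewrite mulr0; case: ifP.
  apply: le_trans (capweight_ge al p a2 x a2p p1); apply: ler_wpM2r => //.
  by apply: ge0_ler_powR; rewrite ?nnegrE ?caplevel_ge0//; lra.
rewrite AE.
have rE : r = (kap `^ p^-1)^-1 * (r `^ p * kap) `^ p^-1.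
  rewrite powRM ?powR_ge0 ?(ltW kap0)// -powRrM divff ?gt_eqF// powRr1 ?ltW//.
  by rewrite mulrCA mulVf ?mulr1// gt_eqF// powR_gt0.
rewrite [X in (X%:E <= _)%E]rE EFinM; apply: lee_wpmul2l; first by rewrite lee_fin.
rewrite -poweR_EFin; apply: gt0_ler_poweR => //.
- by rewrite invr_ge0 ltW.
- by rewrite in_itv/= leey andbT lee_fin mulr_ge0 ?powR_ge0 ?(ltW kap0).
- by rewrite in_itv/= leey andbT.
Qed.

(** After substituting [d * (1 + x)] for [1 + x] with [d = c^-2], only the factor [x^(be - 1)] does
    not scale exactly. It becomes [(d * x + (d - 1))^(be - 1)], which is at least [(d * x)^(be - 1)]
    because [be >= 1] and [d >= 1]. *)
Lemma capweight_dilate (be a2 c : R) (E : R -> bool) : 1 <= be -> 0 < c <= 1 ->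
  measurable_fun setT E ->
  ((c `^ (1 + a2))%:E * \int[leb]_x
     (if E (c * (1 + x) `^ (- 2^-1))%R then capweight R be a2 x else 0)%R%:E <=
   \int[leb]_x (if E ((1 + x) `^ (- 2^-1))%R then capweight R be a2 x else 0)%R%:E)%E.
Proof.
move=> be1 /andP[c0 c1] mE.
have mw := measurable_capweight R be a2; have w0 x := capweight_ge0 R be a2 x.
pose d := (c ^+ 2)^-1.
have cc0 : 0 < c ^+ 2 by rewrite exprn_gt0.
have d0 : 0 < d by rewrite invr_gt0.
have d1 : 1 <= d by rewrite invf_ge1// expr_le1// ltW.
have dc : d = c `^ (- 2) by rewrite /d powRN powR_mulrn// ltW.
rewrite -integralZ_EFin ?powR_ge0//; last 2 first.
- by measurability.
- by move=> x; case: ifP.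
rewrite [leRHS](@integral_affine R _ d (d - 1)) ?gt_eqF//; last 2 first.
- by measurability.
- by move=> x; rewrite lee_fin; case: ifP.
rewrite gtr0_norm// -integralZ_EFin ?(ltW d0)//; last 2 first.
- by measurability.
- by move=> x; case: ifP.
apply: le_ge0_integral => x _; rewrite lee_fin.
  by rewrite mulr_ge0 ?powR_ge0//; case: ifP.
have [x0|x0] := ltP 0 x; last first.
  rewrite {1}/capweight /pw ltNge x0/= mul0r if_same mulr0.
  by rewrite mulr_ge0 ?(ltW d0)//; case: ifP.
have x10 : 0 < 1 + x by lra.
have -> : 1 + (d * x + (d - 1)) = d * (1 + x) by ring.
have -> : (d * (1 + x)) `^ (- 2^-1) = c * (1 + x) `^ (- 2^-1).
  rewrite powRM ?ltW// dc -powRrM (_ : - 2 * - 2^-1 = 1) ?powRr1 ?ltW//.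
  by field.
case: ifP => _; last by rewrite !mulr0.
rewrite /capweight /pw x0 ifT; last by nra.
have -> : 1 + (d * x + (d - 1)) = d * (1 + x) by ring.
rewrite powRM ?(ltW d0) ?(ltW x10)//.
have -> : c `^ (1 + a2) = d * d `^ (be - 1) * d `^ (- (be + (1 + a2) / 2)).
  rewrite -[X in X * _ * _](powRr1 (ltW d0)) -!powRD_gt0// dc -powRrM.
  by congr (_ `^ _); field.
set V := d `^ (- _); set W := (1 + x) `^ _.
have UZ : d `^ (be - 1) * x `^ (be - 1) <= (d * x + (d - 1)) `^ (be - 1).
  rewrite -powRM ?(ltW d0) ?(ltW x0)//.
  by apply: ge0_ler_powR; rewrite ?nnegrE; nra.
have -> : d * d `^ (be - 1) * V * (x `^ (be - 1) * W) =
  (d `^ (be - 1) * x `^ (be - 1)) * (d * V * W) by ring.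
have -> : d * ((d * x + (d - 1)) `^ (be - 1) * (V * W)) =
  (d * x + (d - 1)) `^ (be - 1) * (d * V * W) by ring.
apply: ler_wpM2r UZ.
by rewrite !mulr_ge0 ?powR_ge0 ?(ltW d0).
Qed.

Lemma layer_cake (g h : R -> R) : measurable_fun setT g -> measurable_fun setT h ->
  (forall x, 0 <= g x) -> (forall x, 0 <= h x) ->
  (\int[leb]_x (g x * h x)%:E = \int[leb]_s
    (if (0 < s)%R then \int[leb]_x (if s < h x then g x else 0)%R%:E else 0))%E.
Proof.
move=> mg mh g0 h0.
pose F (x s : R) : \bar R := (if (0 < s) && (s < h x) then g x else 0)%:E.
have F0 x s : (0 <= F x s)%E by rewrite lee_fin; case: ifP.
have mF : measurable_fun setT (fun z : R * R => F z.1 z.2) by rewrite /F; measurability.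
transitivity (\int[leb]_x \int[leb]_s F x s)%E.
  apply: eq_integral => x _.
  have -> : F x = ((cst (g x)%:E) \_ `]0, h x[%classic).
    by apply/funext => s; rewrite /F /patch mem_setE in_itv; case: ifP.
  rewrite -integral_mkcond integral_cst//=; rewrite lebesgue_measure_itv/= lte_fin.
  case: ifPn => hx; first by rewrite -EFinB -EFinM subr0.
  by rewrite mule0; congr (_%:E); have := h0 x; rewrite le_eqVlt (negbTE hx) orbF => /eqP <-; rewrite mulr0.
rewrite (integral_swap _ (fun z : R * R => F z.1 z.2))//=.
apply: eq_integral => s _; rewrite /F; case: ifPn => s0 //=.
by rewrite integral0.
Qed.

(** Boxes with equal corners have volume 0 because there is at least one entry; a product over no
    entries would be 1. *)
Lemma mx_null_set0 m1 m2 (A : set 'M[R]_(m1.+1, m2.+1)) : A `<=` set0 -> mx_null A.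
Proof.
move=> A0 e e0; exists (fun=> 0), (fun=> 0); split; first by move=> M /A0.
rewrite eseries0 ?lee_fin ?ltW// => j _ _.
by rewrite big_ord_recl big_ord_recl mxE subrr maxxx !mul0r.
Qed.

Lemma weighted_radon_sup_le n k gam (f : 'rV[R]_n.+1 -> R) (V : \bar R) :
  (forall G : 'M[R]_(k.+1, n.+1), admissible G ->
     ((cos (dist0 G) `^ gam)%:E * `|radon G f| <= V)%E) ->
  (weighted_radon_sup k gam f <= V)%E.
Proof.
move=> H; apply: ereal_inf_lbound => /=; apply: mx_null_set0 => G [Gadm].
by rewrite ltNge H.
Qed.

Lemma admissible_gt0 n k (G : 'M[R]_(k.+1, n.+1)) (c : R) :
  dist0 G = acos c -> 0 <= c <= 1 -> row_free G -> admissible G = (0 < c).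
Proof.
move=> dE /andP[c0 c1] Gf; rewrite /admissible dE; move: Gf; rewrite /row_free => -> /=.
have pi0 := pi_gt0 R.
have cI : c \in `[(-1), 1] by rewrite in_itv/=; lra.
have aI : acos c \in `[0, pi] by rewrite in_itv/= acos_ge0 ?acos_lepi//; lra.
have pI : pi / 2 \in `[0, (pi : R)] by rewrite in_itv/=; lra.
by rewrite -(ltr_cos aI pI) acosK// cos_pihalf.
Qed.

(** Level by level, [capdens_restricted] bounds the mass of the superlevel set on [xi], and
    [capweight_dilate] compares the outcome with the measure of the superlevel set on the whole
    sphere. The loss [c^(-(1 + a2) / p)] is absorbed by [c^gam], since [c <= 1]. *)
Lemma radon_bound m j (a1 a2 gam : R) :
  let p := (a1 + j.+1%:R) / m.+1%:R in
  1 <= p -> 1 + a2 <= p -> 2 <= a1 + j.+1%:R -> (1 + a2) / p <= gam ->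
  ineq_star j.+1 m.+1 a1 a2 p gam.
Proof.
move=> p p1 a2p be1 gamp; have p0 : 0 < p by lra.
have [K K0 HK] := radon_formula R m.
have [Kn Kn0 HKn] := mu_formula R j.
pose al : R := m.+1%:R / 2.
have al12 : 2^-1 <= al by rewrite -[X in X <= _]mul1r ler_wpM2r// ?invr_ge0// ler1n.
have alp : al * p = (a1 + j.+1%:R) / 2.
  have hM : m.+1%:R != 0 :> R by rewrite pnatr_eq0.
  by rewrite /al /p; move: hM; move: (m.+1%:R) (j.+1%:R) => M J hM; field.
have [C C0 HC] := capdens_restricted al p a2 al12 p1 a2p.
pose D := K * C * Kn^-1 `^ p^-1.
have D0 : 0 < D by rewrite !mulr_gt0// powR_gt0// invr_gt0.
exists (D / p) => f [F [mF fF]] _.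
have Kn10 : 0 < Kn^-1 by rewrite invr_gt0.
pose mus (s : R) := mu a1 a2 [set x | s < `|f x|]%R.
have mus0 s : (0 <= mus s)%E.
  rewrite /mus (HKn a1 a2 s f F mF fF) mule_ge0 ?lee_fin ?(ltW Kn0)//.
  by apply: integral_ge0 => x _; rewrite lee_fin; case: ifP => // _; exact: capweight_ge0.
have mmus : measurable_fun setT mus.
  have mw := measurable_capweight R ((a1 + j.+1%:R) / 2) a2.
  rewrite (_ : mus = (fun s => Kn%:E * \int[leb]_x
      (if s < `|F ((1 + x) `^ (- 2^-1))| then capweight R ((a1 + j.+1%:R) / 2) a2 x else 0)%R%:E)%E); last first.
    by apply/funext => s; exact: HKn.
  apply: emeasurable_funM; first by measurability.
  apply: (measurable_integral_snd R (fun z : R * R =>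
    (if z.1 < `|F ((1 + z.2) `^ (- 2^-1))| then capweight R ((a1 + j.+1%:R) / 2) a2 z.2 else 0)%:E)).
    by measurability.
  by move=> z; rewrite lee_fin; case: ifP => // _; exact: capweight_ge0.
pose L := (\int[leb]_s (if (0 < s)%R then mus s `^ p^-1 else 0))%E.
have LE : lorentz_norm a1 a2 p f = (p%:E * L)%E.
  rewrite /lorentz_norm integral_mkcond; congr (_ * _)%E; apply: eq_integral => s _.
  by rewrite /patch mem_setE in_itv/= andbT.
rewrite LE muleA -EFinM divfK ?gt_eqF//.
apply: weighted_radon_sup_le => G Gadm.
have Gf : row_free G by case/andP: Gadm.
have [c [c01 dE cE _] HG] := HK _ G Gf.
have c0 : 0 < c by rewrite -(admissible_gt0 _ _ G c dE c01 Gf).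
have [_ c1] := andP c01.
rewrite cE.
apply: (@le_trans _ _ ((c `^ gam)%:E * radon G (fun x => `|f x|%R)))%E.
  by apply: lee_wpmul2l; rewrite ?lee_fin ?powR_ge0//; exact: abse_radon.
have mF' : measurable_fun setT (fun t => `|F t|) by measurability.
have fF' x : sphere x -> `|f x| = `|F `|x ord0 ord_max| | by move=> xS; rewrite fF.
rewrite (HG _ _ mF' (fun t => normr_ge0 _) fF').
have mg := measurable_capdens R al.
have mFc : measurable_fun setT (fun x : R => `|F (c * (1 + x) `^ (- 2^-1))|) by measurability.
rewrite (layer_cake _ _ mg mFc (capdens_ge0 R al) (fun x => normr_ge0 _)).
rewrite muleA -EFinM.
have mmp : measurable_fun setT (fun s : R => if (0 < s)%R then mus s `^ p^-1 else 0)%E.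
  apply: measurable_fun_ifT; [by measurability| |by measurability].
  exact: (measurableT_comp (measurable_poweR _)).
have m0 s : (0 <= if (0 < s)%R then mus s `^ p^-1 else 0)%E by case: ifP => // _; exact: poweR_ge0.
rewrite -[leRHS]ge0_integralZl//; last by rewrite lee_fin ltW.
rewrite -[leLHS]ge0_integralZl//; last 3 first.
- apply: measurable_fun_ifT; [by measurability| |by measurability].
  apply: (measurable_integral_snd R (fun z : R * R =>
    (if z.1 < `|F (c * (1 + z.2) `^ (- 2^-1))| then capdens R al z.2 else 0)%:E)).
    by measurability.
  by move=> z; rewrite lee_fin; case: ifP => // _; exact: capdens_ge0.
- move=> s _; case: ifP => // _; apply: integral_ge0 => x _.
  by rewrite lee_fin; case: ifP => // _; exact: capdens_ge0.
- by rewrite lee_fin mulr_ge0 ?powR_ge0 ?ltW.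
have cgK : 0 <= c `^ gam * K by rewrite mulr_ge0 ?powR_ge0 ?ltW.
apply: le_ge0_integral => s _.
  rewrite mule_ge0 ?lee_fin//; case: ifP => // _; apply: integral_ge0 => x _.
  by rewrite lee_fin; case: ifP => // _; exact: capdens_ge0.
case: ifP => _; last by rewrite !mule0.
pose E (t : R) := s < `|F t|.
have mE : measurable_fun setT E by rewrite /E; measurability.
pose E' (x : R) := E (c * (1 + x) `^ (- 2^-1)).
have mE' : measurable_fun setT E' by rewrite /E'; measurability.
apply: (le_trans (lee_wpmul2l _ (HC E' mE'))); first by rewrite lee_fin.
set B := (\int[leb]_x _)%E.
have B0 : (0 <= B)%E.
  by apply: integral_ge0 => x _; rewrite lee_fin; case: ifP => // _; exact: capweight_ge0.
have be1' : 1 <= al * p by rewrite alp; lra.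
have c0c1 : 0 < c <= 1 by rewrite c0.
have dil := capweight_dilate (al * p) a2 c E be1' c0c1 mE.
have musE : mus s = (Kn%:E * \int[leb]_x (if E ((1 + x) `^ (- 2^-1)) then capweight R (al * p) a2 x else 0)%R%:E)%E.
  by rewrite alp; exact: HKn.
have Bmus : ((c `^ (1 + a2))%:E * B <= (Kn^-1)%:E * mus s)%E.
  by rewrite musE muleA -EFinM mulVf ?gt_eqF// mul1e.
have ip0 : 0 <= p^-1 by rewrite invr_ge0 ltW.
have cg : c `^ gam <= (c `^ (1 + a2)) `^ p^-1.
  by rewrite -powRrM; apply: ger_powR.
apply: (@le_trans _ _ ((K * C)%:E * ((c `^ (1 + a2))%:E * B) `^ p^-1)%E).
  rewrite poweRM ?lee_fin ?powR_ge0// !muleA -!EFinM.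
  apply: lee_wpmul2r; first exact: poweR_ge0.
  rewrite lee_fin.
  have -> : c `^ gam * K * C = K * C * c `^ gam by ring.
  by apply: ler_wpM2l => //; rewrite mulr_ge0 ?ltW.
rewrite /D [(K * C * _)%:E]EFinM -muleA; apply: lee_wpmul2l.
  by rewrite lee_fin mulr_ge0 ?ltW.
have -> : ((Kn^-1 `^ p^-1)%:E * mus s `^ p^-1 = ((Kn^-1)%:E * mus s) `^ p^-1)%E.
  by rewrite poweRM ?lee_fin ?(ltW Kn10).
apply: gt0_ler_poweR => //.
- by rewrite in_itv/= leey andbT mule_ge0 ?lee_fin ?powR_ge0.
- by rewrite in_itv/= leey andbT mule_ge0 ?lee_fin ?(ltW Kn10).
Qed.

End Sufficiency.

(** * Boxes of matrices are not null *)

Section Boxes.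
Variable R : realType.
Notation leb := (@lebesgue_measure R).

Definition itvind (a b x : R) : R := if (a <= x) && (x <= b) then 1 else 0.

Lemma itvind_ge0 a b x : 0 <= itvind a b x.
Proof. by rewrite /itvind; case: ifP. Qed.

Lemma integral_itvind (C a b : R) : 0 <= C ->
  (\int[leb]_t (C * itvind a b t)%:E = (C * Num.max (b - a) 0)%:E)%E.
Proof.
move=> C0; have [ab|ab] := leP a b.
  rewrite max_l ?subr_ge0// -integral_itv_cst//; apply: eq_integral => t _.
  by rewrite /itvind; case: ifP => _; rewrite ?mulr1 ?mulr0.
rewrite max_r ?subr_le0 ?ltW// mulr0 integral0_eq// => t _; rewrite /itvind ifF ?mulr0//.
by apply/negbTE/negP => /andP[h1 h2]; lra.
Qed.

(* Integrating the covering inequality of indicator functions one coordinate at a time. *)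
Lemma box_cover_volume (I : eqType) (s : seq I) (a b : I -> R) (aj bj : nat -> I -> R)
    (C : R) (c : nat -> R) : uniq s -> 0 <= C -> (forall j, 0 <= c j) ->
  (forall v : I -> R, ((C * \prod_(i <- s) itvind (a i) (b i) (v i))%:E <=
    \sum_(0 <= j <oo) (c j * \prod_(i <- s) itvind (aj j i) (bj j i) (v i))%:E)%E) ->
  ((C * \prod_(i <- s) Num.max (b i - a i) 0)%:E <=
    \sum_(0 <= j <oo) (c j * \prod_(i <- s) Num.max (bj j i - aj j i) 0)%:E)%E.
Proof.
elim: s C c => [|i s ih] C c /=.
  move=> _ _ _ /(_ (fun=> 0)); rewrite !big_nil => h; apply: le_trans h _.
  rewrite le_eqVlt; apply/orP; left; apply/eqP; apply: eq_eseriesr => j _.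
  by rewrite !big_nil.
move=> /andP[inis us] C0 c0 h.
rewrite big_cons mulrA.
have -> : (\sum_(0 <= j <oo) (c j * \prod_(i <- (i :: s)) Num.max (bj j i - aj j i) 0)%:E =
  \sum_(0 <= j <oo) ((c j * Num.max (bj j i - aj j i) 0) * \prod_(i <- s) Num.max (bj j i - aj j i) 0)%:E)%E.
  by apply: eq_eseriesr => j _; rewrite big_cons mulrA.
(* The side lengths in the coordinate [i] are absorbed in the constants [C] and [c]; it remains to
   integrate the hypothesis in this coordinate. *)
apply: ih => //.
- by rewrite mulr_ge0// le_max lexx orbT.
- by move=> j; rewrite mulr_ge0// le_max lexx orbT.
move=> v; pose vt t i' := if i' == i then t else v i'.
have prodE (u w : I -> R) t : \prod_(i' <- s) itvind (u i') (w i') (vt t i') =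
    \prod_(i' <- s) itvind (u i') (w i') (v i').
  rewrite big_seq [RHS]big_seq; apply: eq_bigr => i' i's; rewrite /vt ifF//.
  by apply/negbTE; apply: contraNneq inis => <-.
have p0 (u w : I -> R) : 0 <= \prod_(i' <- s) itvind (u i') (w i') (v i').
  by apply: prodr_ge0 => *; exact: itvind_ge0.
have ht t : ((C * \prod_(i <- s) itvind (a i) (b i) (v i) * itvind (a i) (b i) t)%:E <=
    \sum_(0 <= j <oo) (c j * \prod_(i <- s) itvind (aj j i) (bj j i) (v i) * itvind (aj j i) (bj j i) t)%:E)%E.
  have := h (vt t); rewrite big_cons prodE {1}/vt eqxx => hh.
  rewrite -mulrA [X in (C * X)%R]mulrC; apply: (le_trans hh).
  rewrite le_eqVlt; apply/orP; left; apply/eqP; apply: eq_eseriesr => j _.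
  by rewrite big_cons prodE {1}/vt eqxx -mulrA [in RHS](mulrC (\prod_(_ <- _) _)).
have CP0 : 0 <= C * \prod_(i <- s) itvind (a i) (b i) (v i) by rewrite mulr_ge0.
have cP0 j : 0 <= c j * \prod_(i <- s) itvind (aj j i) (bj j i) (v i) by rewrite mulr_ge0.
rewrite mulrAC -integral_itvind//.
have -> : (\sum_(0 <= j <oo) (c j * Num.max (bj j i - aj j i) 0 * \prod_(i0 <- s) itvind (aj j i0) (bj j i0) (v i0))%:E =
   \sum_(0 <= j <oo) \int[leb]_t (c j * \prod_(i0 <- s) itvind (aj j i0) (bj j i0) (v i0) * itvind (aj j i) (bj j i) t)%:E)%E.
  by apply: eq_eseriesr => j _; rewrite mulrAC -integral_itvind.
rewrite -integral_nneseries//; last 2 first.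
- by move=> j; rewrite /itvind; measurability.
- by move=> j t _; rewrite lee_fin mulr_ge0// itvind_ge0.
by apply: le_ge0_integral => t _ //; rewrite lee_fin mulr_ge0// itvind_ge0.
Qed.

(** The box of half side [e] around [G] lies in [A], so the indicators of boxes covering [A] add up
    to at least its own indicator. Their volumes then add up to at least [V], against the bound
    [V / 2]. *)
Lemma box_not_null m1 m2 (A : set 'M[R]_(m1, m2)) (G : 'M[R]_(m1, m2)) (e : R) :
  0 < e -> (forall M : 'M[R]_(m1, m2), (forall i j, `|M i j - G i j| <= e) -> A M) -> ~ mx_null A.
Proof.
move=> e0 GA nullA.
pose I : finType := ('I_m1 * 'I_m2)%type.
pose V := \prod_(p : I) (2 * e).
have V0 : 0 < V by apply: prodr_gt0 => p _; rewrite mulr_gt0.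
have V20 : 0 < V / 2 by rewrite divr_gt0.
have [a [b [Aab sumab]]] := nullA _ V20.
have := @box_cover_volume I (index_enum I) (fun p => G p.1 p.2 - e) (fun p => G p.1 p.2 + e)
  (fun j p => a j p.1 p.2) (fun j p => b j p.1 p.2) 1 (fun=> 1)
  (index_enum_uniq _) ler01 (fun=> ler01).
have -> : 1 * \prod_(p : I) Num.max (G p.1 p.2 + e - (G p.1 p.2 - e)) 0 = V.
  rewrite mul1r; apply: eq_bigr => p _; rewrite max_l; lra.
have -> : (\sum_(0 <= j <oo) (1 * \prod_(p : I) Num.max (b j p.1 p.2 - a j p.1 p.2) 0)%:E =
  \sum_(0 <= j <oo) (\prod_(i < m1) \prod_(l < m2) Num.max (b j i l - a j i l) 0)%:E)%E.
  by apply: eq_eseriesr => j _; rewrite mul1r pair_big.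
move=> h; have /le_trans/(_ sumab) : (V%:E <= \sum_(0 <= j <oo) (\prod_(i < m1) \prod_(l < m2) Num.max (b j i l - a j i l) 0)%:E)%E.
  apply: h => v; rewrite mul1r.
  have t0 j : (0 <= (1 * \prod_(p : I) itvind (a j p.1 p.2) (b j p.1 p.2) (v p))%:E :> \bar R)%E.
    by rewrite lee_fin mul1r prodr_ge0// => *; exact: itvind_ge0.
  have [/forallP vin|] := boolP [forall p, (G p.1 p.2 - e <= v p) && (v p <= G p.1 p.2 + e)].
    rewrite big1; last by move=> p _; rewrite /itvind vin.
    have [j _ Mj] : (\bigcup_j [set M | forall i l, a j i l <= M i l <= b j i l])
        (\matrix_(i, l) v (i, l)).
      apply: Aab; apply: GA => i l; rewrite mxE; have := vin (i, l).
      by rewrite /= ler_norml => /andP[? ?]; apply/andP; split; lra.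
    apply: le_trans (nneseries_lim_ge j.+1 _); last by move=> *; exact: t0.
    rewrite big_nat_recr//= -[X in (X <= _)%E]add0e leeD//.
      by apply: sume_ge0 => i _; exact: t0.
    rewrite mul1r big1// => p _; rewrite /itvind.
    by have := Mj p.1 p.2; rewrite mxE -surjective_pairing => ->.
  rewrite negb_forall => /existsP[p hp].
  rewrite (bigD1 p)//= /itvind (negbTE hp) mul0r.
  by apply: nneseries_ge0 => j _ _; exact: t0.
by rewrite lee_fin; lra.
Qed.

End Boxes.

(** * Gram determinants and the set of subspaces at a prescribed distance *)

Section GramDet.
Variable R : realType.

(** With the unit vector [e] appended to the rows, block elimination leaves the Schur complement
    [1 - q^T q], where [q] is the column [l] of [Q]. For full-rank [G] this makes [1 - c^2] a
    quotient of two polynomials in the entries of [G], hence continuous without following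
    Gram-Schmidt. *)
Lemma gram_det_extend m N (l : 'I_N) (G Q : 'M[R]_(m, N)) (T : 'M[R]_m) :
  G = T *m Q -> Q *m Q^T = 1%:M ->
  \det (col_mx G (delta_mx (0 : 'I_1) l) *m (col_mx G (delta_mx (0 : 'I_1) l))^T) =
    (\det T) ^+ 2 * (1 - \sum_i Q i l ^+ 2).
Proof.
move=> GE QQ; pose e : 'rV[R]_N := delta_mx 0 l.
have -> : col_mx G e = block_mx T 0 0 1%:M *m col_mx Q e.
  by rewrite mul_block_col !mul0mx mul1mx addr0 add0r GE.
rewrite trmx_mul mulmxA -(mulmxA (block_mx _ _ _ _)) !det_mulmx det_tr.
have -> : \det (block_mx T 0 0 1%:M : 'M[R]_(m + 1)) = \det T by rewrite det_ublock det1 mulr1.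
rewrite mulrAC -expr2; congr (_ * _).
rewrite tr_col_mx mul_col_row QQ.
pose q : 'cV[R]_m := Q *m e^T.
have -> : e *m Q^T = q^T by rewrite trmx_mul trmxK.
have -> : e *m e^T = 1%:M.
  rewrite trmx_delta mul_delta_mx; apply/matrixP => i j; rewrite !ord1 !mxE.
  by [].
have -> : block_mx 1%:M q q^T 1%:M =
  block_mx 1%:M 0 q^T 1%:M *m block_mx 1%:M q 0 (1%:M - q^T *m q) :> 'M[R]_(m + 1).
  rewrite mulmx_block !mul0mx !mulmx0 !mul1mx !mulmx1 !addr0 addrC subrK.
  by [].
rewrite det_mulmx det_lblock det_ublock !det1 !mul1r det_mx11 !mxE eqxx mulr1n.
congr (_ - _); apply: eq_bigr => i _.
have qE : q i 0 = Q i l by rewrite /q /e trmx_delta -colE mxE.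
by rewrite mxE qE expr2.
Qed.

Lemma continuous_mul_fun (T : topologicalType) (f g : T -> R) :
  continuous f -> continuous g -> continuous (fun x => f x * g x).
Proof. by move=> cf cg x; apply: cvgM; [exact: cf|exact: cg]. Qed.

Lemma continuous_sub_fun (T : topologicalType) (f g : T -> R) :
  continuous f -> continuous g -> continuous (fun x => f x - g x).
Proof. by move=> cf cg x; apply: cvgB; [exact: cf|exact: cg]. Qed.

Lemma continuous_sum_fun (T : topologicalType) (I : Type) (s : seq I) (f : I -> T -> R) :
  (forall i, continuous (f i)) -> continuous (fun x => \sum_(i <- s) f i x).
Proof.
move=> cf; elim: s => [|i s ih] x.
  have -> : (fun x => \sum_(i <- [::]) f i x) = cst 0 by apply/funext => y; rewrite big_nil.
  exact: cst_continuous.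
have -> : (fun x => \sum_(j <- i :: s) f j x) = f i \+ (fun x => \sum_(j <- s) f j x).
  by apply/funext => y; rewrite big_cons.
by apply: continuousD; [exact: cf|exact: ih].
Qed.

Lemma continuous_prod_fun (T : topologicalType) (I : Type) (s : seq I) (f : I -> T -> R) :
  (forall i, continuous (f i)) -> continuous (fun x => \prod_(i <- s) f i x).
Proof.
move=> cf; elim: s => [|i s ih] x.
  have -> : (fun x => \prod_(i <- [::]) f i x) = cst 1 by apply/funext => y; rewrite big_nil.
  exact: cst_continuous.
have -> : (fun x => \prod_(j <- i :: s) f j x) = (fun x => f i x * \prod_(j <- s) f j x).
  by apply/funext => y; rewrite big_cons.
by apply: continuousM; [exact: cf|exact: ih].
Qed.

Lemma continuous_gram_det (T : topologicalType) m N (A : T -> 'M[R]_(m, N)) :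
  (forall i j, continuous (fun x => A x i j)) ->
  continuous (fun x => \det (A x *m (A x)^T)).
Proof.
move=> cA; have cG i j : continuous (fun x => (A x *m (A x)^T) i j).
  have -> : (fun x => (A x *m (A x)^T) i j) = (fun x => \sum_l A x i l * A x j l).
    by apply/funext => x; rewrite mxE; apply: eq_bigr => l _; rewrite mxE.
  by apply: continuous_sum_fun => l; apply: continuous_mul_fun; exact: cA.
rewrite /determinant; apply: continuous_sum_fun => s.
apply: continuous_mul_fun; first exact: cst_continuous.
by apply: continuous_prod_fun => i; exact: cG.
Qed.

Lemma row_free_gram_det m N (G : 'M[R]_(m, N)) : \det (G *m G^T) != 0 -> row_free G.
Proof.
move=> d0; apply: inj_row_free => v vG.
have u : G *m G^T \in unitmx by rewrite unitmxE unitfE.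
by rewrite -[v](mulmxK u) mulmxA vG !mul0mx.
Qed.

(** The rows are the first [k] coordinate vectors and a unit vector in the plane of the next one and
    the pole, tilted so that its last coordinate is [c]; [k < n] keeps that next vector distinct
    from the pole. *)
Lemma tilted_frame n k (c : R) : (k < n)%N -> 0 <= c <= 1 ->
  exists2 Q : 'M[R]_(k.+1, n.+1), Q *m Q^T = 1%:M &
    \sum_i Q i ord_max ^+ 2 = c ^+ 2.
Proof.
move=> kn /andP[c0 c1]; have kn1 : (k.+1 <= n.+1)%N by rewrite ltnS ltnW.
pose w := widen_ord kn1.
pose s := Num.sqrt (1 - c ^+ 2).
have s2 : s ^+ 2 = 1 - c ^+ 2 by rewrite sqr_sqrtr//; nra.
pose sg (i : 'I_k.+1) : R := if i == ord_max then s else 1.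
pose cg (i : 'I_k.+1) : R := if i == ord_max then c else 0.
pose Q : 'M[R]_(k.+1, n.+1) := \matrix_(i, j) (sg i * (j == w i)%:R + cg i * (j == ord_max)%:R).
have wmax i : (w i == ord_max) = false.
  by apply/negbTE; rewrite -val_eqE/= neq_ltn (leq_ltn_trans _ kn)// -ltnS.
have Qr i : row i Q = sg i *: delta_mx 0 (w i) + cg i *: delta_mx 0 ord_max.
  by apply/rowP => j; rewrite !mxE.
exists Q.
  apply/matrixP => i j.
  have -> : (Q *m Q^T) i j = (row i Q *m (row j Q)^T) 0 0.
    by rewrite !mxE; apply: eq_bigr => l _; rewrite !mxE.
  have -> : (row j Q)^T = sg j *: delta_mx (w j) 0 + cg j *: delta_mx ord_max 0.
    by rewrite Qr linearD/= !linearZ/= !trmx_delta.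
  rewrite Qr mulmxDl !mulmxDr -!scalemxAl -!scalemxAr.
  rewrite !mul_delta_mx_cond !mxE/= wmax [ord_max == _]eq_sym wmax eqxx.
  have -> : (w i == w j) = (i == j) by [].
  rewrite !mulr0n !mulr1n !mxE/= !mulr0 addr0 add0r !mulr1 /sg /cg.
  have [->|ij] := eqVneq i j.
    rewrite !mulr1n !mxE/= mulr1; case: ifP => _; last by rewrite mulr1 mulr0 addr0.
    by rewrite -!expr2 s2 subrK.
  rewrite !mulr0n !mxE !mulr0 add0r; case: eqP => [ei|_]; last by rewrite mul0r.
  by rewrite ifF ?mulr0//; apply/negbTE; rewrite -ei eq_sym.
rewrite (bigD1 ord_max)//= big1 ?addr0.
  by rewrite mxE /sg /cg !eqxx [ord_max == _]eq_sym wmax mulr0 add0r mulr1.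
by move=> i im; rewrite mxE /cg (negbTE im) [ord_max == _]eq_sym wmax mulr0 mul0r addr0 expr0n.
Qed.

Lemma nbhs_mx_box m1 m2 (G : 'M[R]_(m1, m2)) (U : set 'M[R]_(m1, m2)) : nbhs G U ->
  exists2 e : R, 0 < e & forall M : 'M[R]_(m1, m2), (forall i j, `|M i j - G i j| <= e) -> U M.
Proof.
move=> /nbhs_ballP[e e0 eU]; exists (e / 2); first by rewrite divr_gt0.
move=> M MG; apply: eU; split => // i j; rewrite /ball/= distrC.
by apply: le_lt_trans (MG i j) _; rewrite gtr_pMr// invf_lt1// ltr1n.
Qed.

(** For the Gram determinants [phi] and [psi] without and with the pole one has
    [psi = phi * (1 - c^2)], so [c1 < c < c2] amounts to strict inequalities between continuous
    functions of [G]. They hold at the frame tilted by the midpoint of [c1] and [c2], hence on a box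
    around it. *)
Lemma tilt_not_null n k (c1 c2 : R) (A : set 'M[R]_(k.+1, n.+1)) : (k < n)%N ->
  0 <= c1 -> c1 < c2 -> c2 <= 1 ->
  (forall G, row_free G -> (forall c Q T, G = T *m Q -> Q *m Q^T = 1%:M -> 0 < \det T ->
     0 <= c -> c ^+ 2 = \sum_i Q i ord_max ^+ 2 -> c1 < c < c2) -> A G) -> ~ mx_null A.
Proof.
move=> kn c10 c12 c21 HA.
pose c := (c1 + c2) / 2.
have c01 : 0 <= c <= 1 by rewrite /c; lra.
have [Q0 QQ0 Q0c] := tilted_frame n k c kn c01.
pose E (G : 'M[R]_(k.+1, n.+1)) := col_mx G (delta_mx (0 : 'I_1) (ord_max : 'I_n.+1)).
pose phi (G : 'M[R]_(k.+1, n.+1)) : R := \det (G *m G^T).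
pose psi (G : 'M[R]_(k.+1, n.+1)) : R := \det (E G *m (E G)^T).
have cphi : continuous phi by apply: continuous_gram_det => i j; exact: coord_continuous.
have cpsi : continuous psi.
  apply: continuous_gram_det => i j; rewrite /E.
  case: (split_ordP i) => i' ->.
    under eq_fun do rewrite col_mxEu; exact: coord_continuous.
  under eq_fun do rewrite col_mxEd; exact: cst_continuous.
have Q0E : Q0 = 1%:M *m Q0 by rewrite mul1mx.
have phi0 : phi Q0 = 1 by rewrite /phi QQ0 det1.
have psi0 : psi Q0 = 1 - c ^+ 2.
  by rewrite /psi /E (gram_det_extend _ _ _ _ _ _ Q0E QQ0) det1 expr1n mul1r Q0c.
pose f1 := (fun G => (1 - c1 ^+ 2) * phi G - psi G).
pose f2 := (fun G => psi G - (1 - c2 ^+ 2) * phi G).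
have pos (f : 'M[R]_(k.+1, n.+1) -> R) : continuous f -> 0 < f Q0 -> \forall G \near Q0, 0 < f G.
  by move=> cf f0; have := cf Q0; move/cvgr_gt; apply.
have cf1 : continuous f1.
  by apply: continuous_sub_fun => //; apply: continuous_mul_fun => //; exact: cst_continuous.
have cf2 : continuous f2.
  by apply: continuous_sub_fun => //; apply: continuous_mul_fun => //; exact: cst_continuous.
have f10 : 0 < f1 Q0 by rewrite /f1 phi0 psi0 /c; nra.
have f20 : 0 < f2 Q0 by rewrite /f2 phi0 psi0 /c; nra.
have phi00 : 0 < phi Q0 by rewrite phi0.
have near : nbhs Q0 [set G | [/\ 0 < phi G, 0 < f1 G & 0 < f2 G]].
  near=> G; split; near: G; exact: pos.
have [e e0 He] := nbhs_mx_box _ _ _ _ near.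
apply: (box_not_null R _ _ A Q0 e e0) => G /He[p0 q1 q2].
apply: HA; first by apply: row_free_gram_det; rewrite gt_eqF.
move=> d Q T GE QQ T0 d0 dE.
have phiE : phi G = (\det T) ^+ 2.
  by rewrite /phi GE trmx_mul mulmxA -(mulmxA T) QQ mulmx1 det_mulmx det_tr expr2.
have psiE : psi G = (\det T) ^+ 2 * (1 - d ^+ 2).
  by rewrite /psi /E (gram_det_extend _ _ _ _ _ _ GE QQ) dE.
move: q1 q2; rewrite /f1 /f2 phiE psiE.
have T20 : 0 < (\det T) ^+ 2 by rewrite exprn_gt0.
rewrite [(1 - c1 ^+ 2) * _]mulrC [(1 - c2 ^+ 2) * _]mulrC -!mulrBr !pmulr_rgt0// => q1 q2.
by apply/andP; split; nra.
Unshelve. all: by end_near. Qed.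

End GramDet.

(** * Necessity of the conditions by testing on bands *)

Section Necessity.
Variable R : realType.
Notation leb := (@lebesgue_measure R).

Lemma powR_le_endpoints (a b x r : R) : 0 < a -> a <= x <= b -> x `^ r <= a `^ r + b `^ r.
Proof.
move=> a0 /andP[ax xb]; have x0 : 0 < x by exact: lt_le_trans ax.
have [r0|r0] := leP 0 r.
  apply: (@le_trans _ _ (b `^ r)); last by rewrite lerDr powR_ge0.
  by apply: ge0_ler_powR; rewrite ?nnegrE// ltW// (lt_le_trans x0).
apply: (@le_trans _ _ (a `^ r)); last by rewrite lerDl powR_ge0.
rewrite -[r]opprK !(powRN _ (- r)) lef_pV2 ?posrE ?powR_gt0//.
by apply: ge0_ler_powR; rewrite ?nnegrE ?oppr_ge0// ltW.
Qed.

Lemma powR_ge_endpoints (a b r : R) : 0 < a -> exists2 m : R, 0 < m &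
  forall x, a <= x <= b -> m <= x `^ r.
Proof.
move=> a0; exists (a `^ (- r) + b `^ (- r))^-1.
  by rewrite invr_gt0 ltr_wpDr ?powR_ge0 ?powR_gt0.
move=> x xab; have x0 : 0 < x by case/andP: xab => ax _; exact: lt_le_trans ax.
rewrite -[X in _ <= X]invrK lef_pV2 ?posrE ?invr_gt0 ?powR_gt0//; last first.
  by rewrite ltr_wpDr ?powR_ge0 ?powR_gt0.
by rewrite -powRN; exact: powR_le_endpoints.
Qed.

Lemma powR_compare (a b C : R) :
  (forall t, 0 < t <= 1 / 2 -> t `^ a <= C * t `^ b) -> b <= a.
Proof.
move=> H; rewrite leNgt; apply/negP => ab.
pose d := b - a; have d0 : 0 < d by rewrite subr_gt0.
have C0 : 0 <= C.
  have h : 0 < (1 / 2 : R) by lra.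
  have /H h2 : 0 < (1 / 2 : R) <= 1 / 2 by rewrite h lexx.
  by rewrite -(pmulr_lge0 _ (powR_gt0 b h)) (le_trans _ h2)// powR_ge0.
(* At [t = s / 2] one has [t^d = 2^(-d) / (C + 1)], hence [C * t^d < 1], which contradicts the
   hypothesis. *)
pose s := (C + 1) `^ (- d^-1).
have C1 : 1 <= C + 1 by lra.
have s0 : 0 < s by rewrite powR_gt0//; lra.
have s1 : s <= 1.
  by rewrite /s -[leRHS](powRr0 (C + 1)); apply: ler_powR; rewrite // oppr_le0 invr_ge0 ltW.
have t0 : 0 < s / 2 by rewrite divr_gt0.
have /H : 0 < s / 2 <= 1 / 2 by rewrite t0 ler_wpM2r// invr_ge0.
have -> : b = a + d by rewrite /d; ring.
rewrite powRD_gt0// mulrCA -[X in X <= _]mulr1 ler_pM2l ?powR_gt0//.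
rewrite powRM ?(ltW s0)// /s -powRrM mulNr mulVf ?gt_eqF// powR_inv1; last by lra.
have h2 : (2^-1 : R) `^ d <= 1.
  rewrite -[leRHS](powRr0 2^-1); apply: ger_powR; last exact: ltW.
  by apply/andP; split; lra.
rewrite mulrA.
have : C / (C + 1) < 1 by rewrite ltr_pdivrMr; lra.
have : 0 <= C / (C + 1) by rewrite divr_ge0//; lra.
have := powR_ge0 (2^-1 : R) d.
by move: (_ `^ d) h2 (C / (C + 1)) => u hu v; nra.
Qed.

Lemma integral_EFin_ge0 (f : R -> R) : (forall x, 0 <= f x) ->
  (0 <= \int[leb]_x (f x)%:E)%E.
Proof. by move=> f0; apply: integral_ge0 => x _; rewrite lee_fin. Qed.

(** The test function is the indicator of [E] in [|x_{n+1}|], whose Lorentz norm is [p] times a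
    power of the measure. The inequality may fail on a null set of subspaces, but those with [c] in
    a given interval do not form a null set, so one of them satisfies it. *)
Lemma ineq_star_test m j (a1 a2 p gam : R) : (m.+1 < j.+1)%N -> 0 < p ->
  ineq_star j.+1 m.+1 a1 a2 p gam ->
  exists2 C : R, 0 < C & forall (E : R -> bool) (c1 c2 v : R), measurable_fun setT E ->
    0 <= c1 -> c1 < c2 -> c2 <= 1 -> 0 < v ->
    (\int[leb]_x (if E ((1 + x) `^ (- 2^-1)) then
       capweight R ((a1 + j.+1%:R) / 2) a2 x else 0)%R%:E <= v%:E)%E ->
    exists2 c, c1 < c < c2 &
    ((c `^ gam)%:E * \int[leb]_x (if E (c * (1 + x) `^ (- 2^-1)) then
       capdens R (m.+1%:R / 2) x else 0)%R%:E
      <= (C * v `^ p^-1)%:E)%E.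
Proof.
move=> mj p0 [C0 HC0].
have [K K0 HK] := radon_formula R m.
have [Kn Kn0 HKn] := mu_formula R j.
(* [C0] may be negative, hence the absolute value; the added 1 makes the bound strict, so that some
   essential upper bound [M] lies below it. *)
pose B := (`|C0| + 1) * (p * Kn `^ p^-1).
have B0 : 0 < B by rewrite !mulr_gt0 ?powR_gt0// ltr_wpDl.
exists (B / K); first by rewrite divr_gt0.
move=> E c1 c2 v mE c10 c12 c21 v0 hv.
pose F (t : R) : R := if E t then 1 else 0.
have mF : measurable_fun setT F by rewrite /F; measurability.
have F0 t : 0 <= F t by rewrite /F; case: ifP.
pose f (x : 'rV[R]_j.+2) : R := F `|x ord0 ord_max|.
have fF x : sphere x -> f x = F `|x ord0 ord_max| by [].
pose V := (Kn * v) `^ p^-1.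
have V0 : 0 < V by rewrite powR_gt0// mulr_gt0.
have ip0 : 0 < p^-1 by rewrite invr_gt0.
(* The superlevel sets at heights [s >= 1] are empty, so the integrand is at most [V] for
   [0 < s < 1] and vanishes beyond. *)
have norm_le : (lorentz_norm a1 a2 p f <= (p * V)%:E)%E.
  rewrite /lorentz_norm EFinM; apply: lee_wpmul2l; first by rewrite lee_fin ltW.
  rewrite integral_mkcond -[V]mulr1 -[X in V * X](subr0 1).
  apply: integral_le_on_itv => //; first exact: ltW.
    by move=> s; rewrite /patch; case: ifP => // _; exact: poweR_ge0.
  move=> s; rewrite /patch mem_setE in_itv/= andbT; case: ifPn => s0; last first.
    by case: ifP => // _; rewrite lee_fin ltW.
  rewrite (HKn a1 a2 s f F mF fF) (ltW s0)/=; case: ifPn => s1.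
    rewrite -poweR_EFin; apply: gt0_ler_poweR; first exact: ltW.
    - rewrite in_itv/= leey andbT mule_ge0 ?lee_fin ?(ltW Kn0)//.
      by apply: integral_EFin_ge0 => x; case: ifP => // _; exact: capweight_ge0.
    - by rewrite in_itv/= leey andbT lee_fin mulr_ge0// ltW.
    rewrite EFinM; apply: lee_wpmul2l; first by rewrite lee_fin ltW.
    apply: le_trans hv; apply: le_ge0_integral => x _; rewrite lee_fin.
      by case: ifP => // _; exact: capweight_ge0.
    have w0 := capweight_ge0 R ((a1 + j.+1%:R) / 2) a2 x.
    rewrite /F; case: (E _); first by case: ifP.
    by rewrite normr0 ltNge (ltW s0).
  rewrite integral0_eq ?mule0 ?poweR0r ?gt_eqF// => x _; rewrite ifF//.
  apply/negbTE; rewrite -leNgt; move: s1; rewrite -ltNge => s1.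
  by rewrite /F; case: ifP => _; rewrite ?normr1 ?normr0; lra.
have sup_le : (weighted_radon_sup m.+1 gam f < (B * v `^ p^-1)%:E)%E.
  apply: (@le_lt_trans _ _ (`|C0| * (p * V))%:E); last first.
    rewrite lte_fin /B /V powRM ?(ltW Kn0) ?(ltW v0)//.
    have -> : (`|C0| + 1) * (p * Kn `^ p^-1) * v `^ p^-1 =
      `|C0| * (p * (Kn `^ p^-1 * v `^ p^-1)) + p * (Kn `^ p^-1 * v `^ p^-1) by ring.
    by rewrite ltrDl !mulr_gt0 ?powR_gt0.
  apply: le_trans (HC0 f _ _) _.
  - by exists F.
  - exact: le_lt_trans norm_le (ltry _).
  have L0 : (0 <= lorentz_norm a1 a2 p f)%E.
    rewrite /lorentz_norm mule_ge0 ?lee_fin ?(ltW p0)//.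
    by apply: integral_ge0 => s _; exact: poweR_ge0.
  apply: (@le_trans _ _ (`|C0|%:E * lorentz_norm a1 a2 p f)%E).
    by apply: lee_wpmul2r => //; rewrite lee_fin ler_norm.
  by rewrite [(`|C0| * _)%:E]EFinM; apply: lee_wpmul2l.
have [M Mnull MB] := ereal_inf_lt sup_le.
(* If no [c] worked, the null set would contain all full-rank [G] with [c] between [c1] and [c2]. *)
apply: contrapT => nex.
apply: (tilt_not_null R j.+1 m.+1 c1 c2 _ mj c10 c12 c21 _ Mnull) => G Gf HG.
have [c [c01 dE cE [Q [T [GE QQ T0 cQ]]]] Hrad] := HK _ G Gf.
have cc : c1 < c < c2 by apply: (HG c Q T) => //; case/andP: c01.
have c0 : 0 < c by case/andP: cc => h _; exact: le_lt_trans h.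
split; first by rewrite (admissible_gt0 R _ _ G c dE c01 Gf).
apply: (lt_trans MB); rewrite cE (Hrad f F mF F0 fF).
rewrite ltNge; apply/negP => le; apply: nex; exists c => //.
set I := (\int[leb]_x (if E _ then _ else _)%R%:E)%E.
have IE : (\int[leb]_x (capdens R (m.+1%:R / 2) x * F (c * (1 + x) `^ (- 2^-1)))%:E = I)%E.
  by apply: eq_integral => x _; rewrite /F; case: ifP => _; rewrite ?mulr1 ?mulr0.
have I0 : (0 <= I)%E.
  by apply: integral_EFin_ge0 => x; case: ifP => // _; exact: capdens_ge0.
move: le; rewrite IE gee0_abs; last by rewrite mule_ge0 ?lee_fin ?(ltW K0).
move=> le.
have -> : (B / K * v `^ p^-1 = K^-1 * (B * v `^ p^-1))%R by ring.
rewrite [leRHS]EFinM.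
have -> : ((c `^ gam)%:E * I = (K^-1)%:E * ((c `^ gam)%:E * (K%:E * I)))%E.
  rewrite [RHS]muleCA; congr (_ * _)%E.
  by rewrite muleA -EFinM mulVf ?gt_eqF// mul1e.
by apply: lee_wpmul2l => //; rewrite lee_fin invr_ge0 ltW.
Qed.

Lemma sqr_powRN12 (c y : R) : 0 < y -> (c * y `^ (- 2^-1)) ^+ 2 = c ^+ 2 / y.
Proof.
by move=> y0; rewrite exprMn powRN powR12_sqrt ?ltW// exprVn sqr_sqrtr ?ltW.
Qed.

(** Bounding [t ^+ 2] avoids square roots: at [t = c * (1 + x)^(-1/2)] it equals [c^2 / (1 + x)]. *)
Definition sqband (lo hi t : R) : bool := (lo <= t ^+ 2) && (t ^+ 2 <= hi).

Lemma measurable_sqband lo hi : measurable_fun setT (sqband lo hi).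
Proof. by rewrite /sqband; measurability. Qed.

Lemma integral_capweight_le (be a2 lo hi a b w : R) : a <= b -> 0 <= w ->
  (forall x, 0 < x -> lo <= (1 + x)^-1 <= hi -> a <= x <= b /\ capweight R be a2 x <= w) ->
  (\int[leb]_x (if sqband lo hi ((1 + x) `^ (- 2^-1)) then capweight R be a2 x else 0)%R%:E
     <= (w * (b - a))%:E)%E.
Proof.
move=> ab w0 h; apply: integral_le_on_itv => // x.
  by rewrite lee_fin; case: ifP => // _; exact: capweight_ge0.
have [x0|x0] := ltP 0 x; last first.
  by rewrite /capweight /pw ltNge x0/= mul0r if_same; case: ifP.
rewrite /sqband -[(1 + x) `^ _]mul1r sqr_powRN12; last by lra.
rewrite expr1n mul1r; case: ifPn => [/h -/(_ x0)[/andP[-> ->] //]|_]; last by case: ifP.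
Qed.

Lemma integral_capdens_ge (al c lo hi a b w : R) : 0 < a -> a <= b -> 0 <= w ->
  (forall x, a <= x <= b -> lo <= c ^+ 2 / (1 + x) <= hi /\ w <= capdens R al x) ->
  ((w * (b - a))%:E <= \int[leb]_x
    (if sqband lo hi (c * (1 + x) `^ (- 2^-1)) then capdens R al x else 0)%R%:E)%E.
Proof.
move=> a0 ab w0 h; apply: integral_ge_on_itv => // x.
  by rewrite lee_fin; case: ifP => // _; exact: capdens_ge0.
move=> xab; have [hE hw] := h x xab.
rewrite lee_fin /sqband sqr_powRN12; last by case/andP: xab => ? ?; lra.
by rewrite hE.
Qed.

(** On the sphere the band is [4 * d <= 1 + x <= 16 * d] with [d = c0^-2], where [capweight] is at
    most of order [d^(-e)]; its mass is at most of order [d^(1 - e) = c0^(1 + a2)]. For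
    [c0 < c < 3/2 * c0] it contains the fixed piece [8 <= x <= 15] of [xi], whose mass is bounded
    below. Then [c0] tends to 0. *)
Lemma gamma_necessary m j (a1 a2 p gam : R) : (m.+1 < j.+1)%N -> 1 <= p ->
  1 <= a1 + j.+1%:R -> ineq_star j.+1 m.+1 a1 a2 p gam -> (1 + a2) / p <= gam.
Proof.
move=> mj p1 be1 HI; have p0 : 0 < p by lra.
have [C C0 HC] := ineq_star_test m j a1 a2 p gam mj p0 HI.
pose al : R := m.+1%:R / 2; pose be := (a1 + j.+1%:R) / 2.
have al0 : 0 <= al by rewrite divr_ge0.
have be12 : 1 / 2 <= be by rewrite ler_wpM2r// invr_ge0.
(* The decay exponent of [capweight] at infinity: [(be - 1) - (be + (1 + a2) / 2) = - e]. *)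
pose e := (3 + a2) / 2.
pose D := (4 : R) `^ (- e) + 16 `^ (- e).
have D0 : 0 < D by rewrite addr_gt0// powR_gt0.
have [m0 m00 Hm0] := powR_ge_endpoints 1 (3 / 2) gam ltr01.
pose g1 : R := 15^-1 * (16 : R) `^ (- (al + 2^-1)).
have g10 : 0 < g1 by rewrite mulr_gt0 ?invr_gt0 ?powR_gt0.
pose W := C * (24 * D) `^ p^-1 / (m0 * (g1 * 7)).
apply: (powR_compare _ _ W) => c0 /andP[c00 c01].
pose d := (c0 ^+ 2)^-1.
have cc0 : 0 < c0 ^+ 2 by rewrite exprn_gt0.
have d0 : 0 < d by rewrite invr_gt0.
have d4 : 4 <= d by rewrite /d -[leLHS]invrK lef_pV2 ?posrE ?invr_gt0//; nra.
have dE r : d `^ r = c0 `^ (- 2 * r).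
  by rewrite /d powRrM powRN powR_mulrn// ltW.
pose v := 24 * D * c0 `^ (1 + a2).
have v0 : 0 < v by rewrite !mulr_gt0 ?powR_gt0.
have hv : (\int[leb]_x (if sqband (c0 ^+ 2 / 16) (c0 ^+ 2 / 4) ((1 + x) `^ (- 2^-1)) then
    capweight R be a2 x else 0)%R%:E <= v%:E)%E.
  have -> : v = 2 * (D * d `^ (- e)) * (16 * d - 4 * d).
    have cd : c0 `^ (1 + a2) = d `^ (- e) * d.
      rewrite -[X in _ * X](powRr1 (ltW d0)) -powRD_gt0// dE.
      by congr (_ `^ _); rewrite /e; field.
    by rewrite /v cd; ring.
  have -> : 16 * d - 4 * d = (16 * d - 1) - (4 * d - 1) by ring.
  apply: integral_capweight_le.
  - by lra.
  - by rewrite !mulr_ge0 ?powR_ge0// ltW.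
  move=> x x0 /andP[h1 h2]; have x10 : 0 < 1 + x by lra.
  have y1 : 1 + x <= 16 * d.
    rewrite -[leLHS]invrK /d -[16]invrK -invfM lef_pV2 ?posrE ?invr_gt0 ?mulr_gt0 ?invr_gt0//.
    by rewrite mulrC.
  have y2 : 4 * d <= 1 + x.
    rewrite -[leRHS]invrK /d -[4]invrK -invfM lef_pV2 ?posrE ?invr_gt0 ?mulr_gt0 ?invr_gt0//.
    by rewrite mulrC.
  split; first by apply/andP; split; lra.
  have y3 : 4 * d <= 1 + x <= 16 * d by rewrite y1 y2.
  have d40 : 0 < 4 * d by lra.
  have ye : (1 + x) `^ (- e) <= D * d `^ (- e).
    apply: le_trans (powR_le_endpoints _ _ _ (- e) d40 y3) _.
    by rewrite !powRM ?(ltW d0)// /D mulrDl.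
  apply: (@le_trans _ _ (2 * (1 + x) `^ (- e))); last by rewrite ler_pM2l.
  rewrite /capweight /pw x0.
  have -> : - e = (be - 1) + - (be + (1 + a2) / 2) by rewrite /e; field.
  rewrite (powRD_gt0 R (1 + x) (be - 1) _ x10) mulrA; apply: ler_wpM2r; first exact: powR_ge0.
  have [b1|b1] := leP 1 be.
    apply: (@le_trans _ _ ((1 + x) `^ (be - 1))).
      by apply: ge0_ler_powR; rewrite ?nnegrE; lra.
    by rewrite ler_peMl ?powR_ge0// ler1n.
  (* For [be < 1] the power [x^(be - 1)] is decreasing, but [1 + x <= 2 * x] costs only the factor
     [2^(1 - be) <= 2]. *)
  have -> : be - 1 = - (1 - be) by ring.
  rewrite !powRN ler_pdivlMr ?powR_gt0// mulrC ler_pdivrMr ?powR_gt0//.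
  apply: (@le_trans _ _ ((2 * x) `^ (1 - be))).
    by apply: ge0_ler_powR; rewrite ?nnegrE; lra.
  rewrite powRM ?(ltW x0)//; apply: ler_wpM2r; first exact: powR_ge0.
  apply: ler1_powR; lra.
have c02 : c0 < 3 / 2 * c0 by lra.
have c03 : 3 / 2 * c0 <= 1 by lra.
have [c /andP[ca cb]] := HC _ _ _ _ (measurable_sqband _ _) (ltW c00) c02 c03 v0 hv.
have dens : ((g1 * 7)%:E <= \int[leb]_x
    (if sqband (c0 ^+ 2 / 16) (c0 ^+ 2 / 4) (c * (1 + x) `^ (- 2^-1)) then capdens R al x else 0)%R%:E)%E.
  have -> : (7 : R) = 15 - 8 by ring.
  apply: integral_capdens_ge; [by []|by rewrite ler_nat|exact: ltW|].
  move=> x /andP[x8 x15]; have x10 : 0 < 1 + x by lra.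
  split.
    have h1 : c0 ^+ 2 <= c ^+ 2 by rewrite ler_sqr ?nnegrE ?ltW// (lt_trans c00).
    have h2 : c ^+ 2 <= (3 / 2 * c0) ^+ 2.
      by rewrite ler_sqr ?nnegrE ?ltW// (lt_trans c00)// (lt_trans ca).
    rewrite (ler_pdivlMr _ _ x10) (ler_pdivrMr _ _ x10).
    move: h2; rewrite exprMn; clear - x8 x15 h1 cc0.
    move: (c0 ^+ 2) (c ^+ 2) cc0 h1 => q r q0 h1 h2.
    have e94 : (3 / 2) ^+ 2 = 9 / 4 :> R by field.
    rewrite e94 in h2.
    have p1 : 0 <= q * (15 - x) by rewrite mulr_ge0 ?subr_ge0// ltW.
    have p2 : 0 <= q * (x - 8) by rewrite mulr_ge0 ?subr_ge0// ltW.
    by apply/andP; split; lra.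
  have x0 : 0 < x by lra.
  rewrite /g1 /capdens /pw x0; apply: ler_pM; rewrite ?invr_ge0 ?powR_ge0//.
    apply: (@le_trans _ _ (x `^ (-1))).
      by rewrite powR_inv1 ?(ltW x0)// lef_pV2 ?posrE.
    by apply: ler_powR; lra.
  rewrite !powRN lef_pV2 ?posrE ?powR_gt0//.
  by apply: ge0_ler_powR; rewrite ?nnegrE; lra.
move=> hC; have : ((c `^ gam)%:E * (g1 * 7)%:E <= (C * v `^ p^-1)%:E)%E.
  by apply: le_trans hC; apply: lee_wpmul2l => //; rewrite lee_fin powR_ge0.
rewrite -EFinM lee_fin => hC2.
have cg : m0 * c0 `^ gam <= c `^ gam.
  have -> : c = (c / c0) * c0 by rewrite divfK// gt_eqF.
  have cc1 : 1 <= c / c0 <= 3 / 2.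
    by rewrite ler_pdivlMr// mul1r ler_pdivrMr// (ltW ca) (ltW cb).
  rewrite (powRM gam _ (ltW c00)); last by case/andP: cc1 => ? _; lra.
  by apply: ler_wpM2r; [exact: powR_ge0|exact: Hm0].
have hv2 : v `^ p^-1 = (24 * D) `^ p^-1 * c0 `^ ((1 + a2) / p).
  by rewrite /v powRM ?powR_ge0 ?mulr_ge0 ?(ltW D0)// -powRrM.
rewrite /W mulrAC ler_pdivlMr ?mulr_gt0// -[C * _ * _]mulrA -hv2.
apply: le_trans hC2.
have -> : c0 `^ gam * (m0 * (g1 * 7)) = m0 * c0 `^ gam * (g1 * 7) by ring.
by apply: ler_wpM2r => //; rewrite mulr_ge0 ?(ltW g10).
Qed.

(** On the sphere the band is [1 <= x <= 1 + 2 * t], of mass at most of order [t]. For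
    [(2 + t)^-1 < c^2 < 2^-1] it contains the piece [t / 8 <= x <= t / 4] of [xi], where [capdens]
    is of order [x^(-1/2)]; the mass of this piece is at least of order [t^(1/2)]. As [t] tends to 0
    this forces [1/p <= 1/2]. *)
Lemma exponent_necessary j (a1 a2 p gam : R) : (1 < j.+1)%N -> 1 <= p ->
  ineq_star j.+1 1 a1 a2 p gam -> 2 <= p.
Proof.
move=> mj p1 HI; have p0 : 0 < p by lra.
have [C C0 HC] := ineq_star_test 0 j a1 a2 p gam mj p0 HI.
pose be := (a1 + j.+1%:R) / 2.
pose g := - (be + (1 + a2) / 2).
pose D := (1 `^ (be - 1) + 3 `^ (be - 1)) * (2 `^ g + 4 `^ g) : R.
have D0 : 0 < D by rewrite mulr_gt0// addr_gt0// powR_gt0.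
have h12 : 0 < 1 / 2 :> R by lra.
have [m0 m00 Hm0] := powR_ge_endpoints (1 / 2) 1 gam h12.
pose W := C * (2 * D) `^ p^-1 / (m0 * 8^-1).
suff : p^-1 <= 2^-1 by rewrite lef_pV2 ?posrE.
apply: (powR_compare _ _ W) => t /andP[t0 t1].
pose v := 2 * D * t.
have v0 : 0 < v by rewrite !mulr_gt0.
pose lo := (2 + 2 * t)^-1; pose hi : R := 2^-1.
have hv : (\int[leb]_x (if sqband lo hi ((1 + x) `^ (- 2^-1)) then
    capweight R be a2 x else 0)%R%:E <= v%:E)%E.
  have -> : v = D * ((1 + 2 * t) - 1) by rewrite /v; ring.
  apply: integral_capweight_le.
  - by lra.
  - exact: ltW.
  move=> x x0 /andP[h1 h2]; have x10 : 0 < 1 + x by lra.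
  have y1 : 1 + x <= 2 + 2 * t.
    by move: h1; rewrite lef_pV2 ?posrE//; lra.
  have y2 : 2 <= 1 + x.
    by move: h2; rewrite lef_pV2 ?posrE.
  split; first by apply/andP; split; lra.
  rewrite /capweight /pw x0; apply: ler_pM; rewrite ?powR_ge0//.
    by apply: powR_le_endpoints; [exact: ltr01|apply/andP; split; lra].
  by apply: powR_le_endpoints => //; apply/andP; split; lra.
pose c1 := Num.sqrt (2 + t)^-1; pose c2 : R := Num.sqrt 2^-1.
have c1E : c1 ^+ 2 = (2 + t)^-1 by rewrite sqr_sqrtr// invr_ge0; lra.
have c2E : c2 ^+ 2 = 2^-1 by rewrite sqr_sqrtr// invr_ge0.
have c10 : 0 <= c1 by exact: sqrtr_ge0.
have c20 : 0 <= c2 by exact: sqrtr_ge0.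
have c12 : c1 < c2.
  by rewrite ltr_sqrt ?invr_gt0// ltf_pV2 ?posrE//; lra.
have c21 : c2 <= 1 by nra.
have c112 : 1 / 2 <= c1.
  have : 1 / 4 <= c1 ^+ 2 by rewrite c1E div1r lef_pV2 ?posrE//; lra.
  by nra.
have [c /andP[ca cb]] := HC _ _ _ _ (measurable_sqband lo hi) c10 c12 c21 v0 hv.
have cc1 : (2 + t)^-1 <= c ^+ 2 by rewrite -c1E; nra.
have cc2 : c ^+ 2 <= 2^-1 by rewrite -c2E; nra.
pose w := 2^-1 * (t / 4) `^ (- 2^-1).
have dens : ((8^-1 * t `^ 2^-1)%:E <= \int[leb]_x
    (if sqband lo hi (c * (1 + x) `^ (- 2^-1)) then capdens R (1%:R / 2) x else 0)%R%:E)%E.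
  have -> : 8^-1 * t `^ 2^-1 = w * (t / 4 - t / 8).
    have -> : t / 4 - t / 8 = 2^-1 * (t / 4) by field.
    rewrite /w mulrACA -[X in _ * (_ * X)](powRr1 (_ : 0 <= t / 4)); last by lra.
    rewrite -powRD_gt0; last by lra.
    have -> : - 2^-1 + 1 = 2^-1 :> R by field.
    rewrite (powRM 2^-1 (ltW t0)) ?invr_ge0//.
    have -> : (4^-1 : R) `^ 2^-1 = 2^-1.
      rewrite powR12_sqrt ?invr_ge0//.
      have -> : (4^-1 : R) = (2^-1) ^+ 2 by field.
      by rewrite sqrtr_sqr ger0_norm ?invr_ge0.
    by field.
  apply: integral_capdens_ge; [by lra|by lra|by rewrite mulr_ge0 ?powR_ge0|].
  move=> x /andP[x1 x2]; have x10 : 0 < 1 + x by lra.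
  have x0 : 0 < x by lra.
  split.
    apply/andP; split.
      (* This follows from [1 <= c^2 * (2 + t)] and [(2 + t) * (1 + x) <= 2 + 2 * t], the latter by
         [x <= t / 4] and the smallness of [t]. *)
      rewrite ler_pdivlMr// /lo mulrC ler_pdivrMr; last by lra.
      have h : 1 <= c ^+ 2 * (2 + t) by rewrite -ler_pdivrMr ?div1r; lra.
      by nra.
    by rewrite ler_pdivrMr// /hi; nra.
  rewrite /w /capdens /pw x0 mulrC; apply: ler_pM; rewrite ?powR_ge0//.
    have -> : 1%:R / 2 - 1 = - 2^-1 :> R by field.
    rewrite !powRN lef_pV2 ?posrE ?powR_gt0//; last by lra.
    by apply: ge0_ler_powR; rewrite ?nnegrE; lra.
  have -> : - (1%:R / 2 + 2^-1) = -1 :> R by field.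
  by rewrite powR_inv1 ?(ltW x10)// lef_pV2 ?posrE//; lra.
move=> hC; have : ((c `^ gam)%:E * (8^-1 * t `^ 2^-1)%:E <= (C * v `^ p^-1)%:E)%E.
  by apply: le_trans hC; apply: lee_wpmul2l => //; rewrite lee_fin powR_ge0.
rewrite -EFinM lee_fin => hC2.
have cg : m0 <= c `^ gam by apply: Hm0; apply/andP; split; lra.
have hv2 : v `^ p^-1 = (2 * D) `^ p^-1 * t `^ p^-1.
  by rewrite /v powRM ?mulr_ge0 ?(ltW D0) ?(ltW t0).
rewrite /W mulrAC ler_pdivlMr ?mulr_gt0 ?invr_gt0// -[C * _ * _]mulrA -hv2.
apply: le_trans hC2.
have -> : t `^ 2^-1 * (m0 / 8) = m0 * (8^-1 * t `^ 2^-1) by ring.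
by apply: ler_wpM2r => //; rewrite mulr_ge0 ?powR_ge0 ?invr_ge0.
Qed.

End Necessity.

(** * The equivalences for [k >= 2] and for [k = 1] *)

Theorem theorem5p9 (R : realType) (n k : nat) (a1 a2 gam : R) :
  (2 <= n)%N -> (1 <= k <= n - 1)%N ->
  k%:R - n%:R <= a1 ->
  1 + a2 <= (a1 + n%:R) / k%:R ->
  (0 < a2 -> 1 + a2 < (a1 + n%:R) / k%:R) ->
  ((2 <= k)%N ->
     (ineq_star n k a1 a2 ((a1 + n%:R) / k%:R) gam <->
      (1 + a2) / ((a1 + n%:R) / k%:R) <= gam)) /\
  (k = 1%N ->
     (ineq_star n k a1 a2 ((a1 + n%:R) / k%:R) gam <->
      (1 + a2) / ((a1 + n%:R) / k%:R) <= gam /\ 2 <= (a1 + n%:R) / k%:R)).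
Proof.
case: n => [//|j] _; case: k => [//|m]; rewrite subn1 /= => mj a1k a2p _.
have k1 : 1 <= m.+1%:R :> R by rewrite ler1n.
have p1 : 1 <= (a1 + j.+1%:R) / m.+1%:R by rewrite ler_pdivlMr ?ltr0n//; lra.
have be1 : 1 <= a1 + j.+1%:R by lra.
have mj1 : (m.+1 < j.+1)%N by rewrite ltnS.
split=> [k2|[m0]].
  have k2' : 2 <= m.+1%:R :> R by rewrite ler_nat.
  split; first exact: gamma_necessary.
  (* From [a1 >= k - n] and [k >= 2] follows [2 <= a1 + n], the condition [be >= 1] of the dilation
     estimate. *)
  by apply: radon_bound => //; lra.
rewrite m0 in mj1 p1 a2p *; rewrite divr1 in p1 a2p *.
split=> [H|[gamp p2]].
  by split; [exact: gamma_necessary H|exact: exponent_necessary H].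
(* For [k = 1] one has [p = a1 + n], so the condition of the dilation estimate is exactly
   [2 <= p]. *)
have := radon_bound R 0 j a1 a2 gam; rewrite /= divr1; apply => //.
Qed.
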